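(* Let $G$ be a connected bipartite graph with color classes $E$ and $V$, let $\mathscr T$ be a triangulation of its root polytope $Q_G$, fix a linear order on $E$, and let $k\ge0$ be an integer. Then the number of interior simplices of $\mathscr T$ of codimension $k$ (i.e. of dimension $|E|+|V|-2-k$) equals the number of pairs $(\mathbf f,S)$ where $\mathbf f$ is a hypertree of the hypergraph $(V,E)$ and $S$ is a set of exactly $k$ distinct hyperedges that are internally inactive with respect to $\mathbf f$.
   Context: Bipartite graphs have no multiple edges. $Q_G\subset\mathbf R^E\oplus\mathbf R^V$ is the convex hull of $\mathbf i_{\{e\}}+\mathbf i_{\{v\}}$ over edges $ev$ of $G$ ($\mathbf i$ = indicator vector); its dimension is $|E|+|V|-2$. A triangulation is a collection of full-dimensional simplices spanned by vertices of $Q_G$, pairwise meeting in common faces, with union $Q_G$; its simplices are all faces of these. A simplex of $\mathscr T$ is interior if it is not contained in the boundary of $Q_G$. A hypertree of $(V,E)$ is a function $\mathbf f\colon E\to\mathbf N$ such that some spanning tree of $G$ has degree $\mathbf f(e)+1$ at each $e\in E$. A hyperedge $e\in E$ is internally active with respect to $\mathbf f$ if there is no $e'<e$ such that decreasing $\mathbf f(e)$ by $1$ and increasing $\mathbf f(e')$ by $1$ yields another hypertree; otherwise it is internally inactive. *)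

(* Defs.v *)
From HB Require Import structures.
From mathcomp Require Import all_boot all_order all_algebra.
From mathcomp Require Import boolp reals.
Set Implicit Arguments. Unset Strict Implicit. Unset Printing Implicit Defensive.
Import Order.TTheory GRing.Theory Num.Theory.
Local Open Scope ring_scope.

Section RootPolytope.
Variables (E V : finType).

Definition adjrel (F : {set E * V}) : rel (E + V) :=
  fun x y => match x, y with
             | inl e, inr v => (e, v) \in F
             | inr v, inl e => (e, v) \in F
             | _, _ => false
             end.

Definition connectedb (F : {set E * V}) : bool :=
  [forall x, [forall y, connect (adjrel F) x y]].

(* F is a spanning tree of G: a connected spanning subgraph of G that is acyclic,
   i.e. every edge of F is a bridge (its endpoints are disconnected in F minus it) *)
Definition spanning_tree (G F : {set E * V}) : bool :=
  [&& F \subset G, connectedb F &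
      [forall p in F, ~~ connect (adjrel (F :\ p)) (inl p.1) (inr p.2)]].

Definition degE (F : {set E * V}) (e : E) : nat := #|[set v | (e, v) \in F]|.

Definition hypertree (G : {set E * V}) (f : E -> nat) : bool :=
  [exists F : {set E * V}, spanning_tree G F && [forall e, degE F e == (f e).+1]].

Definition transfer (f : E -> nat) (e e' : E) : E -> nat :=
  fun x => if x == e then (f e).-1 else if x == e' then (f e').+1 else f x.

(* e is internally inactive w.r.t. f (for the strict linear order lt on E):
   some e' < e such that the transfer yields a hypertree (f e >= 1 is needed so
   that decreasing f(e) stays in N) *)
Definition internally_inactive (G : {set E * V}) (lt : rel E) (f : E -> nat) (e : E)
  : bool :=
  [exists e', [&& lt e' e, (0 < f e)%N & hypertree G (transfer f e e')]].

Variable R : realType.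

Definition point := (E + V)%type -> R.

Definition vert (p : E * V) : point :=
  fun i => match i with
           | inl e => (e == p.1)%:R
           | inr v => (v == p.2)%:R
           end.

Definition in_conv (S : {set E * V}) (x : point) : Prop :=
  exists lam : E * V -> R,
    [/\ forall p, 0 <= lam p,
        forall p, p \notin S -> lam p = 0,
        \sum_p lam p = 1 &
        forall i, x i = \sum_p lam p * vert p i].

Definition aff_indep (S : {set E * V}) : Prop :=
  forall mu : E * V -> R,
    (forall p, p \notin S -> mu p = 0) ->
    \sum_p mu p = 0 ->
    (forall i, \sum_p mu p * vert p i = 0) ->
    forall p, mu p = 0.

(* The root polytope Q_G is in_conv G.  Its (relative) boundary: the union of its
   proper faces, a proper face being the set where a linear functional c attains
   its maximum d over Q_G, for c non-constant on Q_G. *)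
Definition in_boundary (G : {set E * V}) (x : point) : Prop :=
  in_conv G x /\
  exists (c : point) (d : R),
    [/\ forall y, in_conv G y -> \sum_i c i * y i <= d,
        \sum_i c i * x i = d &
        exists y, in_conv G y /\ \sum_i c i * y i < d].

(* T (a set of vertex sets of simplices) is a triangulation of Q_G:
   full-dimensional simplices (dim = |E|+|V|-2) spanned by vertices of Q_G,
   pairwise meeting in a common face, with union Q_G. *)
Definition is_triangulation (G : {set E * V}) (T : {set {set E * V}}) : Prop :=
  [/\ forall S, S \in T ->
        [/\ S \subset G, aff_indep S & #|S| = (#|E| + #|V|).-1]%N,
      forall S1 S2, S1 \in T -> S2 \in T ->
        exists A : {set E * V},
          A \subset S1 :&: S2 /\
          forall x, (in_conv S1 x /\ in_conv S2 x) <-> in_conv A x &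
      forall x, in_conv G x <-> exists2 S, S \in T & in_conv S x].

Definition simplex_of (T : {set {set E * V}}) (A : {set E * V}) : bool :=
  [exists S in T, A \subset S].

Definition interior_simplex (G : {set E * V}) (A : {set E * V}) : Prop :=
  ~ (forall x, in_conv A x -> in_boundary G x).

End RootPolytope.

Arguments in_conv {E V R}.
Arguments in_boundary {E V R}.
Arguments aff_indep {E V R}.
Arguments is_triangulation {E V} R.
Arguments interior_simplex {E V} R.

(* Main.v *)
Require Import Defs.
From HB Require Import structures.
From mathcomp Require Import all_boot all_order all_algebra.
From mathcomp Require Import boolp reals.
From mathcomp Require Import zify ring lra.
Set Implicit Arguments. Unset Strict Implicit. Unset Printing Implicit Defensive.
Import Order.TTheory GRing.Theory Num.Theory.

(* Index an interior simplex A by its degree vector on E minus 1, and a pair (f, S) by f - 1_S.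
   For each vector g the two families have equally many members of index g: for every y, both
   alternating sums over the members of index >= y vanish unless y lies below some hypertree, and
   then both equal the same sign; triangularity of these sums finishes the proof.

   For pairs (f, S), the sum cancels down to the hypertrees f >= y all of whose hyperedges e with
   f(e) > y(e) are active; exchange shows that there is exactly one (the lexicographic maximum).

   For simplices, choose a hypertree h >= y and let z be the point with coordinates h + 1/|E| on E
   and 1 on V, in general position inside the cone over Q_G. Pushing a point of an interior simplex
   A away from z lands inside exactly one maximal simplex S, namely the one with A \subset S such
   that all edges of S \ A carry negative coordinates of z. If z has a negative coordinate on S, a
   flow count gives an edge that can be toggled in A without affecting the condition on degrees,
   so the terms of S cancel; the single S containing z contributes its own term only. *)

Lemma connect_closed_ind (U : finType) (r : rel U) (P : U -> Prop) x y :
  P x -> (forall a b, P a -> r a b -> P b) -> connect r x y -> P y.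
Proof.
move=> Px Pr /connectP[q]; elim: q x Px => [|b q IH] x Px /=; first by move=> _ ->.
by move=> /andP[rxb pq] ey; apply: IH (Pr _ _ Px rxb) pq ey.
Qed.

(** * Spanning trees *)

Section Trees.
Variables E V : finType.
Implicit Types (F H S : {set E * V}) (p r s : E * V) (x y a b : E + V).

Definition incident p x : bool := (x == inl p.1) || (x == inr p.2).

Definition is_tree F : bool :=
  connectedb F && [forall p in F, ~~ connect (adjrel (F :\ p)) (inl p.1) (inr p.2)].

Lemma spanning_treeE G F : spanning_tree G F = (F \subset G) && is_tree F.
Proof. by []. Qed.

Lemma adjrel_sym F : symmetric (adjrel F).
Proof. by case=> ? []. Qed.

Lemma connect_adjC F x y : connect (adjrel F) x y = connect (adjrel F) y x.
Proof. exact: (sym_connect_sym (adjrel_sym F)). Qed.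

Lemma adjrel_edge F p : p \in F -> adjrel F (inl p.1) (inr p.2).
Proof. by case: p. Qed.

Lemma adjrelP F x y : adjrel F x y ->
  exists2 p, p \in F & (x = inl p.1 /\ y = inr p.2) \/ (x = inr p.2 /\ y = inl p.1).
Proof.
case: x y => [e|v] [e'|v'] //= eF; [exists (e, v') | exists (e', v)] => //.
  by left.
by right.
Qed.

Lemma sub_connect F H x y : F \subset H ->
  connect (adjrel F) x y -> connect (adjrel H) x y.
Proof.
move=> /subsetP FH; apply: connect_sub => a b ab; apply: connect1.
by case: a b ab => ? [] ? //= /FH.
Qed.

Lemma tree_connect F x y : is_tree F -> connect (adjrel F) x y.
Proof. by case/andP=> /forallP/(_ x)/forallP. Qed.

Lemma tree_bridge F p : is_tree F -> p \in F ->
  ~~ connect (adjrel (F :\ p)) (inl p.1) (inr p.2).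
Proof. by case/andP=> _ /forall_inP; apply. Qed.

(** The bridge property keeps the two ends of [p] apart. Conversely, a walk in [F] from [inl p.1]
    never leaves the union of the two components, as [p] is the only missing edge. *)
Lemma tree_sides F p x : is_tree F -> p \in F ->
  connect (adjrel (F :\ p)) (inl p.1) x = ~~ connect (adjrel (F :\ p)) (inr p.2) x.
Proof.
move=> tF pF; have nb := tree_bridge tF pF.
have [c1|n1] := boolP (connect (adjrel (F :\ p)) (inl p.1) x).
  apply/esym/negP => c2; case/negP: nb; apply: connect_trans c1 _.
  by rewrite connect_adjC.
apply/esym/negbTE; rewrite negbK.
suff [] : connect (adjrel (F :\ p)) (inl p.1) x \/ connect (adjrel (F :\ p)) (inr p.2) x.
- by move=> c; rewrite c in n1.
- by [].
have := tree_connect (inl p.1) x tF.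
apply: (@connect_closed_ind _ _ (fun z => connect (adjrel (F :\ p)) (inl p.1) z \/
    connect (adjrel (F :\ p)) (inr p.2) z)) => [|a b h ab]; first by left; rewrite connect0.
have [/connect1 abp|] := boolP (adjrel (F :\ p) a b).
  by case: h => h; [left|right]; apply: connect_trans h abp.
move=> nab; have [q qF hq] := adjrelP ab.
have qp : q = p.
  apply: contraNeq nab => qp; have qF' : q \in F :\ p by rewrite in_setD1 qp.
  by case: hq => -[-> ->]; [|rewrite adjrel_sym]; apply: adjrel_edge.
by case: hq => -[_ ->]; rewrite qp connect0; [right|left].
Qed.

Lemma path_avoid F p x b q : incident p x -> path (adjrel F) b q -> x \notin b :: q ->
  connect (adjrel (F :\ p)) b (last b q).
Proof.
move=> px; elim: q b => [|c q IH] b /=; first by rewrite connect0.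
move=> /andP[bc pq]; rewrite inE negb_or => /andP[xb xq].
apply: connect_trans (IH _ pq xq); move: xq; rewrite inE negb_or => /andP[xc _].
apply/connect1; case: b c bc xb xc {pq IH} => [e|v] [e'|v'] //= bc xb xc;
  rewrite in_setD1 bc andbT; apply: contraTneq px => <-;
  by rewrite /incident negb_or /= ?xb ?xc.
Qed.

Lemma tree_first_edge F p x b q : is_tree F -> p \in F -> incident p x -> incident p b ->
  path (adjrel F) b q -> x \notin b :: q ->
  ~~ connect (adjrel (F :\ p)) x (last b q).
Proof.
move=> tF pF px pb pq xq; have cb := path_avoid px pq xq.
apply/negP => cx; case/negP: (tree_bridge tF pF).
have xb : x != b by move: xq; rewrite inE negb_or => /andP[].
move: px pb xb cb cx; rewrite /incident.
move=> /orP[]/eqP-> /orP[]/eqP->; rewrite ?eqxx // => _ cb cx.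
  by apply: connect_trans cx _; rewrite connect_adjC.
by apply: connect_trans cb _; rewrite connect_adjC.
Qed.

Lemma adjrel_incident F x b : adjrel F x b ->
  exists2 p, p \in F & [/\ incident p x, incident p b & forall H, p \in H -> adjrel H x b].
Proof.
move=> /adjrelP[p pF h]; exists p => //; rewrite /incident.
by case: h => -[-> ->]; rewrite !eqxx ?orbT; split=> // H pH; last rewrite adjrel_sym;
  apply: adjrel_edge.
Qed.

(** For [x != y] the only such edge is the first one on the simple path from [x] to [y]: the path
    avoids every other edge at [x]. *)
Lemma tree_sep_card F x y : is_tree F ->
  #|[set p in F | incident p x && ~~ connect (adjrel (F :\ p)) x y]| = (x != y).
Proof.
move=> tF; have [<-|xy] := eqVneq x y.
  by apply: eq_card0 => p; rewrite !inE connect0 !andbF.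
have /connectP[q0 pq0 ey0] := tree_connect x y tF.
case/shortenP: pq0 ey0 xy => -[|b q] //=; first by move=> _ _ _ ->; rewrite eqxx.
move=> /andP[xb pq] /andP[xq _] _ ey _.
have [p pF [px pb hp]] := adjrel_incident xb.
apply/eqP/cards1P; exists p; apply/setP => r; rewrite !inE.
apply/idP/eqP => [/and3P[rF rx]|->]; last first.
  by rewrite pF px ey (tree_first_edge tF).
apply: contraNeq => rp; rewrite ey; apply: connect_trans (path_avoid rx pq xq).
by apply/connect1/hp; rewrite in_setD1 eq_sym rp.
Qed.

(** Every edge of the simple path in [F] from [x] to [y] separates these two, and not all of them
    lie in [H]; the induction finds the first one outside [H]. *)
Lemma tree_sep_edge F H x y : is_tree F -> ~~ connect (adjrel (F :&: H)) x y ->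
  exists2 r, r \in F :\: H & ~~ connect (adjrel (F :\ r)) x y.
Proof.
move=> tF; have /connectP[q0 pq0 ey0] := tree_connect x y tF.
case/shortenP: pq0 ey0 => q pq uq _ ->.
elim: q x pq uq {q0} => [|b q IH] x /=; first by rewrite connect0.
move=> /andP[xb pq] /andP[xq uq].
have [p pF [px pb hp]] := adjrel_incident xb.
have [pH|pH] := boolP (p \in H); last first.
  by exists p; [rewrite !inE pH | apply: tree_first_edge pq xq].
move=> nc; have [|r rFH nr] := IH b pq uq.
  apply: contra nc; apply: connect_trans; apply/connect1/hp.
  by rewrite inE pF.
exists r => //; apply: contra nr; apply: connect_trans.
rewrite connect_adjC; apply/connect1/hp; rewrite in_setD1 pF andbT.
by apply: contraTneq rFH => <-; rewrite inE pH.
Qed.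

Lemma connect_setU1 F p x y : connect (adjrel (p |: F)) x y ->
  [\/ connect (adjrel F) x y,
      connect (adjrel F) x (inl p.1) /\ connect (adjrel F) (inr p.2) y |
      connect (adjrel F) x (inr p.2) /\ connect (adjrel F) (inl p.1) y].
Proof.
apply: (@connect_closed_ind _ _ (fun z => [\/ connect (adjrel F) x z,
    connect (adjrel F) x (inl p.1) /\ connect (adjrel F) (inr p.2) z |
    connect (adjrel F) x (inr p.2) /\ connect (adjrel F) (inl p.1) z])).
  by constructor 1; rewrite connect0.
move=> a b h /adjrelP[q].
rewrite !inE => /orP[/eqP->|qF] hq.
  case: hq h => -[-> ->] [h|[h h']|[h h']].
  - by constructor 2; rewrite connect0.
  - by constructor 2; rewrite connect0.
  - by constructor 1.
  - by constructor 3; rewrite connect0.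
  - by constructor 1.
  - by constructor 3; rewrite connect0.
have ab : connect (adjrel F) a b.
  by apply: connect1; case: hq => -[-> ->]; [|rewrite adjrel_sym]; apply: adjrel_edge.
case: h => [h|[h h']|[h h']].
- by constructor 1; apply: connect_trans ab.
- by constructor 2; split=> //; apply: connect_trans ab.
- by constructor 3; split=> //; apply: connect_trans ab.
Qed.

(** The edge [r] is taken on the cycle that [p] closes in [F]; it can be chosen outside [H] because
    [F :&: H], being contained in [H :\ p], does not connect the ends of [p]. *)
Lemma tree_exchange F H p : is_tree F -> is_tree H -> p \in H :\: F ->
  exists2 r, r \in F :\: H & is_tree (p |: (F :\ r)).
Proof.
move=> tF tH; rewrite inE => /andP[pF pH].
have [r rFH nr] : exists2 r, r \in F :\: H &
    ~~ connect (adjrel (F :\ r)) (inl p.1) (inr p.2).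
  apply: tree_sep_edge => //; apply: contra (tree_bridge tH pH).
  apply: sub_connect; apply/subsetP => s; rewrite !inE => /andP[sF ->].
  by rewrite andbT; apply: contraNneq pF => <-.
exists r => //; move: rFH; rewrite inE => /andP[rH rF].
apply/andP; split.
  apply/forallP => x; apply/forallP => y.
  apply: connect_sub (tree_connect x y tF) => a b /adjrelP[s sF hs].
  suff : connect (adjrel (p |: F :\ r)) (inl s.1) (inr s.2).
    by case: hs => -[-> ->] //; rewrite connect_adjC.
  have [->{s sF hs}|sr] := eqVneq s r; last first.
    by apply/connect1/adjrel_edge; rewrite !inE sF sr orbT.
  have cp : connect (adjrel (p |: F :\ r)) (inl p.1) (inr p.2).
    by apply/connect1/adjrel_edge; rewrite !inE eqxx.
  have sub : F :\ r \subset p |: F :\ r by apply: subsetUr.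
  have [c1|] := boolP (connect (adjrel (F :\ r)) (inl r.1) (inl p.1)).
    apply: connect_trans (sub_connect sub c1) (connect_trans cp _).
    rewrite connect_adjC; apply: (sub_connect sub).
    rewrite -[connect _ _ _]negbK -tree_sides //; apply: contra nr => c2.
    by apply: connect_trans c2; rewrite connect_adjC.
  rewrite tree_sides // negbK => c1.
  rewrite connect_adjC; apply: connect_trans (sub_connect sub c1) (connect_trans cp _).
  rewrite connect_adjC; apply: (sub_connect sub).
  rewrite tree_sides //; apply: contra nr => c2.
  by apply: connect_trans c2; rewrite connect_adjC.
apply/forall_inP => s; rewrite in_setU1 => /orP[/eqP->|].
  by rewrite setU1K // !inE negb_and pF orbT.
rewrite in_setD1 => /andP[sr sF].
have sp : s != p by apply: contraNneq pF => <-.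
have -> : (p |: F :\ r) :\ s = p |: (F :\ r :\ s).
  apply/setP => t; rewrite !inE; have [->|] //= := eqVneq t p.
  by rewrite eq_sym sp.
have sFr : connect (adjrel (F :\ r)) (inl s.1) (inr s.2).
  by apply/connect1/adjrel_edge; rewrite in_setD1 sr.
have sub : F :\ r :\ s \subset F :\ r by apply: subsetDl.
(* A walk that bypasses [s] either avoids [p], against the bridge property of [s] in [F], or
   combines with [s] into a connection of the ends of [p] in [F :\ r]. *)
apply/negP => /connect_setU1[c|[c c']|[c c']].
- case/negP: (tree_bridge tF sF); apply: sub_connect c.
  by apply: setSD; apply: subsetDl.
- case/negP: nr; rewrite connect_adjC in c; rewrite connect_adjC in c'.
  exact: connect_trans (sub_connect sub c) (connect_trans sFr (sub_connect sub c')).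
- case/negP: nr; apply: connect_trans (sub_connect sub c') _.
  rewrite connect_adjC; rewrite connect_adjC in c.
  by apply: connect_trans (sub_connect sub c) sFr.
Qed.

Lemma degE_setD1 F r e : r \in F -> degE F e = (degE (F :\ r) e + (e == r.1))%N.
Proof.
move=> rF; rewrite /degE; have [->|er] := eqVneq e r.1.
  rewrite (cardsD1 r.2) inE -surjective_pairing rF addnC; congr (_ + _)%N.
  apply: eq_card => v; rewrite !inE; congr (~~ _ && _).
  by apply/eqP/eqP => [->|<-] //; case: (r).
rewrite addn0; apply: eq_card => v; rewrite !inE; case: eqVneq => //= er'.
by rewrite -er' eqxx in er.
Qed.

Lemma degE_setU1 F p e : p \notin F -> degE (p |: F) e = (degE F e + (e == p.1))%N.
Proof.
move=> pF; rewrite (@degE_setD1 _ p); last by rewrite setU11.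
by rewrite setU1K.
Qed.

(* Induction on [H :\: F]: if the edge given up for [p] does not lie at a hyperedge with surplus in
   [F], it creates a new deficit there, which the induction hypothesis passes on. *)
Lemma tree_degree_exchange G F H e' :
    spanning_tree G F -> spanning_tree G H -> (degE F e' < degE H e')%N ->
  exists e, (degE H e < degE F e)%N /\ exists2 F1, spanning_tree G F1 &
    forall d, (degE F1 d + (d == e) = degE F d + (d == e'))%N.
Proof.
move: {2}#|H :\: F| (leqnn #|H :\: F|) => n.
elim: n F e' => [|n IH] F e' leHF tF tH lt.
  have /eqP HF : H :\: F == set0 by rewrite -cards_eq0 -leqn0.
  have sHF : H \subset F by rewrite -setD_eq0 HF.
  suff : (degE H e' <= degE F e')%N by lia.
  by apply/subset_leq_card/subsetP => v; rewrite !inE; apply: (subsetP sHF).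
have [p pHF pe] : exists2 p, p \in H :\: F & p.1 = e'.
  have /subsetPn[v] : ~~ ([set v | (e', v) \in H] \subset [set v | (e', v) \in F]).
    by apply/negP => /subset_leq_card; rewrite -/(degE _ _) -/(degE F _); lia.
  by rewrite !inE => vH vF; exists (e', v) => //; rewrite inE vF.
move: tF tH; rewrite !spanning_treeE => /andP[FG tF] /andP[HG tH].
have [r rFH tF1] := tree_exchange tF tH pHF.
move: pHF rFH; rewrite !inE => /andP[pF pH] /andP[rH rF].
set F1 := p |: F :\ r in tF1.
have F1G : F1 \subset G.
  apply/subsetP => s; rewrite !inE => /orP[/eqP->|/andP[_]]; first exact: (subsetP HG).
  exact: (subsetP FG).
have dF1 d : (degE F1 d + (d == r.1) = degE F d + (d == e'))%N.
  rewrite /F1 degE_setU1; last by rewrite !inE negb_and pF orbT.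
  by rewrite (@degE_setD1 F r) // pe addnAC.
have [ltr|ler] := ltnP (degE H r.1) (degE F r.1).
  by exists r.1; split=> //; exists F1 => //; rewrite spanning_treeE F1G.
have [] := IH F1 r.1.
- rewrite -ltnS; apply: leq_trans leHF; apply: proper_card; apply/properP; split.
    apply/subsetP => s; rewrite !inE negb_or negb_and negbK => /andP[/andP[sp sF] sH].
    rewrite sH andbT; case/orP: sF => // /eqP sr.
    by rewrite -sr sH in rH.
  by exists p; rewrite !inE ?eqxx ?pF ?pH.
- by rewrite spanning_treeE F1G.
- by rewrite spanning_treeE HG.
- have := dF1 r.1; rewrite eqxx.
  by case: eqVneq => [re|_]; rewrite ?re in ler *; lia.
move=> e [lte [F2 tF2 dF2]]; exists e; split.
  have := dF1 e; have [ee'|_] := eqVneq e e'; last by case: (e == r.1) => /=; lia.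
  by rewrite ee' in lte *; case: (e' == r.1) => /=; lia.
by exists F2 => // d; have := dF1 d; have := dF2 d; lia.
Qed.

End Trees.

(** * Alternating sums *)

Section SignedSums.
Local Open Scope ring_scope.

(** Toggling the membership of [p] is a sign-reversing involution on the sets satisfying [P]. *)
Lemma sum_sign_toggle0 (U : finType) (P : pred {set U}) (p : U) :
    (forall A : {set U}, p \notin A -> P (p |: A) = P A) ->
  \sum_(A : {set U} | P A) (-1) ^+ #|A| = 0 :> int.
Proof.
move=> hP; pose t (A : {set U}) := if p \in A then A :\ p else p |: A.
have tK : involutive t.
  move=> A; rewrite /t; have [pA|pA] := boolP (p \in A).
    by rewrite setD11 setD1K.
  by rewrite setU11 setU1K.
have tP A : P (t A) = P A.
  rewrite /t; have [pA|pA] := boolP (p \in A); last exact: hP.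
  by rewrite -[in RHS](setD1K pA) hP // setD11.
have tS A : (-1) ^+ #|t A| = - (-1) ^+ #|A| :> int.
  rewrite /t; have [pA|pA] := boolP (p \in A).
    by rewrite [in RHS](cardsD1 p) pA add1n exprS mulN1r opprK.
  by rewrite cardsU1 pA add1n exprS mulN1r.
set s := LHS; suff : s = - s by lia.
rewrite {1}/s (reindex_inj (inv_inj tK)) /= (eq_bigl P) //.
by under eq_bigr do rewrite tS; rewrite sumrN.
Qed.

Lemma sum_sign_subset (U : finType) (B : {set U}) :
  \sum_(A : {set U} | A \subset B) (-1) ^+ #|A| = (B == set0)%:R :> int.
Proof.
have [->|/set0Pn[p pB]] := eqVneq B set0.
  by rewrite (big_pred1 set0) ?cards0 // => A; rewrite subset0.
apply: (@sum_sign_toggle0 _ _ p) => A _.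
by rewrite subUset sub1set pB.
Qed.

(** The order matrix is unitriangular. The induction runs on the total distance [mu] of [g] from the
    top, so all other terms of the upper sum at [g] already vanish. *)
Lemma upper_sums_eq0 (E : finType) (n : nat) (c : {ffun E -> 'I_n} -> int) :
    (forall y : {ffun E -> 'I_n}, \sum_(g : {ffun E -> 'I_n} | [forall e, y e <= g e]%N) c g = 0) ->
  forall g, c g = 0.
Proof.
move=> hc g; pose mu (g : {ffun E -> 'I_n}) := (\sum_e (n - g e))%N.
move: {2}(mu g) (leqnn (mu g)) => m.
elim/ltn_ind: m g => m IH g gm; have := hc g.
rewrite (bigD1 g) /=; last exact/forallP.
rewrite big1 ?addr0 // => g' /andP[/forallP le ne].
apply: (IH (mu g')) => //; apply: leq_trans gm.
have [e ge] : exists e, g' e != g e.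
  apply/existsP; apply: contraNT ne; rewrite negb_exists => /forallP h.
  by apply/eqP/ffunP => e; apply/eqP; rewrite -[_ == _]negbK.
rewrite /mu (bigD1 e) //= [ltnRHS](bigD1 e) //= -addSn leq_add //; last first.
  by apply: leq_sum => i _; apply: leq_sub2l.
have lt : (g e < g' e)%N by rewrite ltn_neqAle le andbT eq_sym; exact: ge.
by have := ltn_ord (g' e); lia.
Qed.

End SignedSums.

(** * Hypertrees and internal activity *)

Section Hypertrees.
Variables (E V : finType) (G : {set E * V}).
Implicit Types f h y : E -> nat.

Lemma eq_hypertree f h : f =1 h -> hypertree G f = hypertree G h.
Proof.
move=> fh; apply: eq_existsb => F; congr (_ && _).
by apply: eq_forallb => e; rewrite fh.
Qed.

Lemma hypertreeP f : reflect
  (exists2 F, spanning_tree G F & forall e, degE F e = (f e).+1) (hypertree G f).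
Proof.
apply: (iffP existsP) => [[F /andP[tF /forallP h]]|[F tF h]].
  by exists F => // e; apply/eqP.
by exists F; rewrite tF; apply/forallP => e; apply/eqP.
Qed.

Lemma hypertree_lt f e : hypertree G f -> f e < #|V|.
Proof. by case/hypertreeP => F _ /(_ e) <-; apply: max_card. Qed.

(** This is the exchange axiom for bases of an integral polymatroid, inherited from exchanges of
    edges between trees. *)
Lemma hypertree_exchange f h e' : hypertree G f -> hypertree G h -> f e' < h e' ->
  exists2 e, h e < f e & hypertree G (transfer f e e').
Proof.
move=> /hypertreeP[F tF dF] /hypertreeP[H tH dH] lt.
have [|e [lte [F1 tF1 dF1]]] := tree_degree_exchange (e' := e') tF tH.
  by rewrite dF dH.
rewrite dF dH in lte; exists e => //; apply/hypertreeP; exists F1 => // d.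
have := dF1 d; rewrite dF /transfer; have [->|_] := eqVneq d e.
  by have [ee'|_] := eqVneq e e'; rewrite ?ee' /= in lte *; lia.
by have [->|_] := eqVneq d e' => /=; lia.
Qed.

Definition dominated y : bool :=
  [exists f : {ffun E -> 'I_#|V|}, hypertree G (fun e => nat_of_ord (f e)) && [forall e, y e <= f e]].

Lemma dominatedP y : reflect (exists2 f, hypertree G f & forall e, y e <= f e) (dominated y).
Proof.
apply: (iffP existsP) => [[f /andP[hf /forallP le]]|[f hf le]].
  by exists (fun e => nat_of_ord (f e)).
exists [ffun e => Ordinal (hypertree_lt e hf)]; rewrite (eq_hypertree (h := f)).
  by rewrite hf; apply/forallP => e; rewrite ffunE.
by move=> e; rewrite ffunE.
Qed.

Variable lt : rel E.
Hypothesis lt_irr : irreflexive lt.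
Hypothesis lt_trans : transitive lt.
Hypothesis lt_total : forall e e', e != e' -> lt e e' || lt e' e.

(* Transfers to smaller hyperedges decrease [\sum_e f e * rank e]. *)
Definition rank e : nat := #|[set e' | lt e' e]|.

Lemma rank_lt e e' : lt e' e -> rank e' < rank e.
Proof.
move=> ee'; apply: proper_card; apply/properP; split.
  by apply/subsetP => d; rewrite !inE => /lt_trans; apply.
by exists e'; rewrite inE ?ee' ?lt_irr.
Qed.

(** While some hyperedge above [y] is inactive, transfer one unit from it to a smaller one: the
    result still dominates [y], and [Phi] drops, so the process stops. *)
Lemma dominated_active_exists y : dominated y -> exists f,
  [/\ hypertree G f, forall e, y e <= f e &
      forall e, y e < f e -> ~~ internally_inactive G lt f e].
Proof.
case/dominatedP => f hf yf; pose Phi f := \sum_e f e * rank e.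
move: {2}(Phi f) (leqnn (Phi f)) => n; elim/ltn_ind: n f hf yf => n IH f hf yf fn.
have [/forallP act|] := boolP [forall e, (y e < f e) ==> ~~ internally_inactive G lt f e].
  by exists f; split=> // e; apply/implyP.
rewrite negb_forall => /existsP[e]; rewrite negb_imply negbK => /andP[ye].
case/existsP => e' /and3P[e'e fe ht].
have ne : e' != e by apply: contraTneq e'e => ->; rewrite lt_irr.
apply: (IH (Phi (transfer f e e')) _ _ ht) => // [|d]; last first.
  rewrite /transfer; have [->|_] := eqVneq d e; first by lia.
  by have [->|_] := eqVneq d e'; [apply: leq_trans (yf _) _; lia | apply: yf].
apply: leq_trans fn; rewrite /Phi (bigD1 e) //= (bigD1 e') //=.
rewrite [ltnRHS](bigD1 e) //= [in ltnRHS](bigD1 e') //=.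
rewrite !addnA -addSn leq_add //.
  rewrite /transfer eqxx (negbTE ne) eqxx.
  have := rank_lt e'e; case: (f e) fe => // m _ /=; rewrite !mulSn; lia.
by apply: leq_sum => d /andP[/negbTE de /negbTE de']; rewrite /transfer de de'.
Qed.

(** Look at the smallest [e'] where the two differ, say [f e' < h e']. Exchange gives [d] with
    [h d < f d] from which [f] can transfer a unit to [e']. By minimality [e'] precedes [d], so [d]
    is inactive for [f] although [y d < f d]. *)
Lemma dominated_active_unique y f h : hypertree G f -> hypertree G h ->
  (forall e, y e <= f e) -> (forall e, y e <= h e) ->
  (forall e, y e < f e -> ~~ internally_inactive G lt f e) ->
  (forall e, y e < h e -> ~~ internally_inactive G lt h e) -> f =1 h.
Proof.
move=> hf hh yf yh af ah e; apply/eqP; apply: contraT => ne.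
case: (@arg_minnP _ e (fun e => f e != h e) rank ne) => e' ne' min.
wlog lt' : f h hf hh yf yh af ah {e ne} ne' min / f e' < h e'.
  move=> wl; move: (ne'); rewrite neq_ltn => /orP[]; first exact: (wl f h).
  by apply: (wl h f) => // [|d]; rewrite eq_sym //; apply: min.
have [d ltd hd] := hypertree_exchange hf hh lt'.
case/negP: (af d (leq_ltn_trans (yh d) ltd)).
apply/existsP; exists e'; rewrite hd (leq_ltn_trans _ ltd) //= andbT.
have dn : f d != h d by rewrite neq_ltn ltd orbT.
have de : e' != d by apply: contraTneq lt' => ->; rewrite -leqNgt ltnW.
case/orP: (lt_total de) => // /rank_lt; rewrite ltnNge; by have := min d dn => ->.
Qed.

Definition inactive_subset (q : {ffun E -> 'I_#|V|} * {set E}) : bool :=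
  hypertree G (fun e => nat_of_ord (q.1 e)) &&
  [forall e in q.2, internally_inactive G lt (fun e => nat_of_ord (q.1 e)) e].

Local Open Scope ring_scope.

(** For a fixed hypertree [f >= y] the admissible sets are all the subsets of [B f], so the signs
    cancel unless [B f] is empty, which happens for exactly one [f] when [y] is dominated. *)
Lemma sum_inactive_subset y :
  \sum_(q | inactive_subset q && [forall e, y e <= q.1 e - (e \in q.2)]%N)
     (-1) ^+ #|q.2| = (dominated y)%:R :> int.
Proof.
pose Q (f : {ffun E -> 'I_#|V|}) := hypertree G (fun e => nat_of_ord (f e)) &&
  [forall e, y e <= f e]%N.
pose B (f : {ffun E -> 'I_#|V|}) := [set e |
  internally_inactive G lt (fun e => nat_of_ord (f e)) e & (y e < f e)%N].
transitivity (\sum_(f | Q f) \sum_(K : {set E} | K \subset B f) (-1) ^+ #|K| : int).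
  rewrite pair_big_dep /=; apply: eq_bigl => -[f K] /=.
  rewrite /inactive_subset /Q /= -!andbA; congr (_ && _).
  apply/andP/andP => [[/forall_inP ina /forallP le]|[/forallP le /subsetP sub]].
    split; first by apply/forallP => e; apply: leq_trans (le e) (leq_subr _ _).
    apply/subsetP => e eK; rewrite inE ina //.
    (* Inactivity includes [0 < f e], so the truncated subtraction of 1 is genuine. *)
    have := le e; rewrite eK; have /existsP[e' /and3P[_ + _]] := ina e eK.
    by move=> /=; lia.
  split; first by apply/forall_inP => e /sub; rewrite inE => /andP[].
  apply/forallP => e; have [/sub|_] := boolP (e \in K); last by rewrite subn0 le.
  by rewrite inE => /andP[_] /=; lia.
under eq_bigr do rewrite sum_sign_subset.
have Bact (f : {ffun E -> 'I_#|V|}) : B f = set0 -> forall e, (y e < f e)%N ->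
    ~~ internally_inactive G lt (fun e => nat_of_ord (f e)) e.
  by move=> /setP B0 e ye; have := B0 e; rewrite !inE ye andbT => ->.
have [dom|ndom] := boolP (dominated y); last first.
  rewrite big1 // => f /andP[hf /forallP yf]; case/negP: ndom.
  by apply/existsP; exists f; rewrite hf; apply/forallP.
have [f [hf yf act]] := dominated_active_exists dom.
pose f0 : {ffun E -> 'I_#|V|} := [ffun e => Ordinal (hypertree_lt e hf)].
have f0E e : f0 e = f e :> nat by rewrite ffunE.
have Q0 : Q f0.
  rewrite /Q (eq_hypertree f0E) hf; apply/forallP => e; by rewrite f0E.
have f0f : (fun e => nat_of_ord (f0 e)) = f by apply: funext.
have B0 : B f0 = set0.
  apply/setP => e; rewrite !inE f0f f0E; apply/negP => /andP[ina ye].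
  by have := act e ye; rewrite ina.
rewrite (bigD1 f0) //= B0 eqxx big1 ?addr0 // => h /andP[/andP[hh /forallP yh] ne].
case: eqVneq => // Bh; case/eqP: ne; apply/ffunP => e; apply: val_inj.
rewrite /= f0E; symmetry.
exact: (dominated_active_unique hf hh yf yh act (Bact h Bh)).
Qed.

End Hypertrees.

(** * Cones over root polytopes *)

Section Cones.
Local Open Scope ring_scope.
Variables (R : realType) (E V : finType).
Implicit Types (S F G A : {set E * V}) (p : E * V) (lam mu : E * V -> R) (x z : point E V R).

Definition comb lam : point E V R := fun i => \sum_p lam p * @vert E V R p i.

Definition supported S lam := forall p, p \notin S -> lam p = 0.

Definition in_cone S x := exists lam,
  [/\ forall p, 0 <= lam p, supported S lam & forall i, x i = comb lam i].

Definition mass x : R := \sum_e x (inl e).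

Lemma vertE p i : @vert E V R p i = (incident p i)%:R.
Proof. by case: i => [e|v]; rewrite /vert /incident /= ?orbF. Qed.

Lemma comb_inl lam e : comb lam (inl e) = \sum_v lam (e, v).
Proof.
transitivity (\sum_e' \sum_v lam (e', v) * @vert E V R (e', v) (inl e)).
  by rewrite pair_bigA; apply: eq_bigr => -[].
rewrite (bigD1 e) //= [X in _ + X]big1 ?addr0.
  by apply: eq_bigr => v _; rewrite eqxx mulr1.
by move=> e' /negbTE ne; rewrite big1 // => v _; rewrite eq_sym ne mulr0.
Qed.

Lemma comb_inr lam v : comb lam (inr v) = \sum_e lam (e, v).
Proof.
transitivity (\sum_e \sum_v' lam (e, v') * @vert E V R (e, v') (inr v)).
  by rewrite pair_bigA; apply: eq_bigr => -[].
apply: eq_bigr => e _; rewrite (bigD1 v) //= eqxx mulr1 big1 ?addr0 //.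
by move=> v' /negbTE ne; rewrite eq_sym ne mulr0.
Qed.

Lemma comb_lin (a b : R) lam mu i :
  comb (fun p => a * lam p + b * mu p) i = a * comb lam i + b * comb mu i.
Proof.
rewrite /comb !mulr_sumr -big_split /=; apply: eq_bigr => p _.
by rewrite mulrDl !mulrA.
Qed.

Lemma mass_comb lam : mass (comb lam) = \sum_p lam p.
Proof.
rewrite /mass (eq_bigr _ (fun e _ => comb_inl lam e)) pair_bigA /=.
by apply: eq_bigr => -[].
Qed.

Lemma eq_mass x z : x =1 z -> mass x = mass z.
Proof. by move=> h; apply: eq_bigr => e _; rewrite h. Qed.

(** Affine independence amounts to linear independence, because all vertices lie on the hyperplane
    of mass 1. *)
Lemma comb_inj S lam mu : @aff_indep E V R S -> supported S lam -> supported S mu ->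
  comb lam =1 comb mu -> lam =1 mu.
Proof.
move=> ai sl sm h p; apply/eqP; rewrite -subr_eq0; apply/eqP.
pose d p := 1 * lam p + (-1) * mu p.
have dE i : comb d i = 0 by rewrite comb_lin h; ring.
have -> : lam p - mu p = d p by rewrite /d; ring.
apply: ai => [q qS||i]; first by rewrite /d sl ?sm //; ring.
  by rewrite -mass_comb (eq_mass dE) /mass big1.
exact: dE.
Qed.

Lemma in_convE S x : in_conv S x <-> in_cone S x /\ mass x = 1.
Proof.
split=> [[lam [l0 ls l1 lx]]|[[lam [l0 ls lx]] m1]].
  by split; [exists lam | rewrite (eq_mass lx) mass_comb].
by exists lam; split=> //; rewrite -mass_comb -(eq_mass lx).
Qed.

Lemma in_cone_scale S x z (a : R) : 0 <= a -> (forall i, z i = a * x i) ->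
  in_cone S x -> in_cone S z.
Proof.
move=> a0 h [lam [l0 ls lx]]; exists (fun p => a * lam p); split.
- by move=> p; apply: mulr_ge0.
- by move=> p /ls ->; rewrite mulr0.
- move=> i; rewrite h lx /comb mulr_sumr; by apply: eq_bigr => p _; rewrite mulrA.
Qed.

Lemma in_coneD S x y z : (forall i, z i = x i + y i) ->
  in_cone S x -> in_cone S y -> in_cone S z.
Proof.
move=> h [lam [l0 ls lx]] [mu [m0 ms mx]].
exists (fun p => 1 * lam p + 1 * mu p); split.
- by move=> p; rewrite !mul1r addr_ge0.
- by move=> p pS; rewrite ls // ms //; ring.
- by move=> i; rewrite h lx mx comb_lin !mul1r.
Qed.

Lemma in_cone_conv S x : in_cone S x -> 0 < mass x ->
  in_conv S (fun i => (mass x)^-1 * x i).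
Proof.
move=> xS m0; apply/in_convE; split.
  by apply: (@in_cone_scale S x _ (mass x)^-1) => //; rewrite invr_ge0 ltW.
by rewrite /mass -mulr_sumr mulVf // gt_eqF.
Qed.

Lemma in_cone_vert S p : p \in S -> in_cone S (@vert E V R p).
Proof.
move=> pS; exists (fun q => (q == p)%:R); split=> [q|q|i].
- exact: ler0n.
- by move=> qS; rewrite (negbTE (contraNneq _ qS)) // => ->.
- rewrite /comb (bigD1 p) //= eqxx mul1r big1 ?addr0 // => q /negbTE ->.
  by rewrite mul0r.
Qed.

Lemma in_cone_sub S A x : S \subset A -> in_cone S x -> in_cone A x.
Proof.
move=> SA [lam [l0 ls lx]]; exists lam; split=> // p pA; apply: ls.
by apply: contra pA; apply: (subsetP SA).
Qed.

(* With this sign change on [E], edges become differences of unit vectors and the linear span of the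
   polytope becomes the hyperplane of vectors with zero sum. *)
Definition sg (i : E + V) : R := if i is inl _ then -1 else 1.

Definition sdelta (x : E + V) : point E V R := fun i => sg x * (i == x)%:R.

Lemma sg_sqr i : sg i * sg i = 1.
Proof. by case: i => ? /=; ring. Qed.

Lemma sg_neq0 i : sg i != 0.
Proof. by case: i => ? /=; rewrite ?oppr_eq0 oner_eq0. Qed.

Lemma vert_sdelta p i : @vert E V R p i = sdelta (inr p.2) i - sdelta (inl p.1) i.
Proof.
by rewrite vertE /sdelta /incident; case: i => [e|v] /=; rewrite ?orbF /=; ring.
Qed.

Lemma comb_vert p i : comb (fun q => (q == p)%:R) i = @vert E V R p i.
Proof.
rewrite /comb (bigD1 p) //= eqxx mul1r big1 ?addr0 // => q /negbTE ->.
by rewrite mul0r.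
Qed.

Lemma sum_sg_vert p : \sum_i sg i * @vert E V R p i = 0.
Proof.
rewrite big_sumType /= (bigD1 p.1) //= (bigD1 p.2) //= !eqxx !big1 => [|v /negbTE->|e /negbTE->];
  by rewrite ?mulr0 //; ring.
Qed.

Lemma sum_sg_comb lam : \sum_i sg i * comb lam i = 0.
Proof.
under eq_bigr do rewrite /comb mulr_sumr.
rewrite exchange_big big1 //= => p _.
under eq_bigr do rewrite mulrCA.
by rewrite -mulr_sumr sum_sg_vert mulr0.
Qed.

(** Edges of the walk enter with sign 1 when traversed from [E] to [V] and with sign -1 otherwise;
    the sum telescopes. *)
Lemma connect_span F (x y : E + V) : connect (adjrel F) x y ->
  exists2 mu, supported F mu & forall i, comb mu i = sdelta y i - sdelta x i.
Proof.
apply: (@connect_closed_ind _ _ (fun y => exists2 mu, supported F mu &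
  forall i, comb mu i = sdelta y i - sdelta x i)).
  exists (fun => 0) => // i; rewrite /comb big1 => [|p _]; by rewrite ?subrr ?mul0r.
move=> a b [mu ms mx] /adjrelP[p pF hp].
have sp q : q \notin F -> (q == p)%:R = 0 :> R.
  by move=> qF; rewrite (negbTE (contraNneq _ qF)) // => ->.
case: hp mx => -[-> ->] mx.
  exists (fun q => 1 * mu q + 1 * (q == p)%:R) => [q qF|i].
    by rewrite sp // ms //; ring.
  by rewrite comb_lin comb_vert mx vert_sdelta; ring.
exists (fun q => 1 * mu q + (-1) * (q == p)%:R) => [q qF|i].
  by rewrite sp // ms //; ring.
by rewrite comb_lin comb_vert mx vert_sdelta; ring.
Qed.

(* The flow through [p] that balances the component of [S :\ p] on the side of [p.2]. *)
Definition tree_coord S z p : R :=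
  if p \in S then \sum_(i | connect (adjrel (S :\ p)) (inr p.2) i) sg i * z i else 0.

Lemma tree_coord_supported S z : supported S (tree_coord S z).
Proof. by move=> p /negbTE pS; rewrite /tree_coord pS. Qed.

(** For an edge [p] at [j], the coordinate is [- sg j] times the balance of the side of [p] away
    from [j]. Each [i != j] lies on the far side of exactly one such edge, so the sum over the edges
    at [j] is [- sg j] times the balance of everything but [j], which is [z j]. *)
Lemma tree_coord_comb S z : is_tree S -> \sum_i sg i * z i = 0 -> comb (tree_coord S z) =1 z.
Proof.
move=> tS z0 j.
have cj p : p \in S -> incident p j -> tree_coord S z p =
    - sg j * \sum_(i | ~~ connect (adjrel (S :\ p)) j i) sg i * z i.
  move=> pS; rewrite /tree_coord pS /incident => /orP[]/eqP->.
    rewrite opprK mul1r; apply: eq_bigl => i.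
    by rewrite tree_sides // negbK.
  (* The two sides of [p] have opposite balances, as the total vanishes. *)
  rewrite mulN1r; apply/eqP; rewrite -subr_eq0 opprK; apply/eqP.
  by rewrite -[RHS]z0 [RHS](bigID (connect (adjrel (S :\ p)) (inr p.2))).
transitivity (- sg j * \sum_i sg i * z i *
    (#|[set p in S | incident p j && ~~ connect (adjrel (S :\ p)) j i]|)%:R).
  transitivity (\sum_(p in S | incident p j)
      - sg j * \sum_(i | ~~ connect (adjrel (S :\ p)) j i) sg i * z i).
    rewrite /comb (bigID (fun p => (p \in S) && incident p j)) /=.
    rewrite [X in _ + X]big1 ?addr0.
      by apply: eq_bigr => p /andP[pS pj]; rewrite vertE pj mulr1 cj.
    move=> p; rewrite negb_and vertE => /orP[/tree_coord_supported ->|/negbTE->].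
      by rewrite mul0r.
    by rewrite mulr0.
  rewrite -mulr_sumr; congr (_ * _).
  under eq_bigr do rewrite big_mkcond.
  rewrite exchange_big /=; apply: eq_bigr => i _.
  rewrite -sum1dep_card natr_sum mulr_sumr -big_mkcondr /=.
  by apply: eq_big => [p|p _]; rewrite ?mulr1 // andbA.
rewrite (bigD1 j) //= tree_sep_card // eqxx mulr0 add0r.
transitivity (- sg j * \sum_(i | i != j) sg i * z i).
  congr (_ * _); apply: eq_bigr => i ij.
  by rewrite tree_sep_card // eq_sym ij mulr1.
have -> : \sum_(i | i != j) sg i * z i = - (sg j * z j).
  by apply/eqP; rewrite -addr_eq0 addrC; apply/eqP; rewrite -[RHS]z0 [RHS](bigD1 j).
by rewrite mulrNN mulrA sg_sqr mul1r.
Qed.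

(** A walk between the ends of [p] that avoids [p] would express [vert p] through the other vertices
    of the simplex. *)
Lemma aff_indep_bridge S p : @aff_indep E V R S -> p \in S ->
  ~~ connect (adjrel (S :\ p)) (inl p.1) (inr p.2).
Proof.
move=> ai pS; apply/negP => /connect_span[mu ms mx].
have sp q : q \notin S -> (q == p)%:R = 0 :> R.
  by move=> qF; rewrite (negbTE (contraNneq _ qF)) // => ->.
have ms' : supported S mu.
  by move=> q qS; apply: ms; rewrite in_setD1 (negbTE qS) andbF.
have /(_ p) : mu =1 (fun q => (q == p)%:R).
  by apply: (comb_inj ai ms' sp) => i; rewrite mx comb_vert vert_sdelta.
by rewrite ms ?setD11 // eqxx => /eqP; rewrite eq_sym oner_eq0.
Qed.

(** Were [y] unreachable from [x], two independent functionals would vanish on all vertices of the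
    simplex: [sg], and [sg] restricted to the component [X] of [x]. Together with [#|E| + #|V| - 1]
    independent vertices this exceeds the dimension [#|E| + #|V|]. *)
Lemma aff_indep_connected S : @aff_indep E V R S ->
  #|S| = (#|E| + #|V|).-1 -> (0 < #|E|)%N -> connectedb S.
Proof.
move=> ai cS E0; apply/forallP => x; apply/forallP => y; apply: contraT => nxy.
pose X i := connect (adjrel S) x i.
have XS p : p \in S -> X (inl p.1) = X (inr p.2).
  move=> pS; apply/idP/idP => h; apply: connect_trans h _; last rewrite connect_adjC.
    exact/connect1/adjrel_edge.
  exact/connect1/adjrel_edge.
pose n := #|{: E + V}|.
pose M : 'M[R]_(#|S|, n) := \matrix_(a, b) @vert E V R (enum_val a) (enum_val b).
pose B : 'M[R]_(2, n) := \matrix_(a, b)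
  (sg (enum_val b) * (if a == 0 then 1 else (X (enum_val b))%:R)).
have rM : row_free M.
  apply: inj_row_free => v vM.
  pose mu p : R := \sum_(a < #|S|) v 0 a * (enum_val a == p)%:R.
  have muE (a : 'I_#|S|) : mu (enum_val a) = v 0 a.
    rewrite /mu (bigD1 a) //= eqxx mulr1 big1 ?addr0 // => b ba.
    by rewrite (inj_eq enum_val_inj) (negbTE ba) mulr0.
  have mus : supported S mu.
    move=> p pS; rewrite /mu big1 // => a _.
    by rewrite (negbTE (contraNneq _ pS)) ?mulr0 // => <-; apply: enum_valP.
  have mu0 i : comb mu i = 0.
    have /matrixP/(_ 0 (enum_rank i)) := vM; rewrite !mxE => <-.
    rewrite /comb (bigID (fun p => p \in S)) /= [X in _ + X]big1 ?addr0.
      rewrite big_enum_val; apply: eq_bigr => a _.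
      by rewrite mxE muE enum_rankK.
    by move=> p /mus ->; rewrite mul0r.
  apply/rowP => a; rewrite mxE -muE; apply: (ai mu mus _ mu0).
  by rewrite -mass_comb (eq_mass mu0) /mass big1.
have rB : row_free B.
  apply: inj_row_free => v vB.
  have vBE i : v 0 0 + v 0 1 * (X i)%:R = 0.
    have /matrixP/(_ 0 (enum_rank i)) := vB; rewrite !mxE big_ord_recl big_ord1.
    rewrite !mxE enum_rankK /= => h; apply: (mulfI (sg_neq0 i)).
    by rewrite mulr0 -[RHS]h (_ : lift _ _ = 1); [ring | apply: val_inj].
  have := vBE y; rewrite /X (negbTE nxy) mulr0 addr0 => v0.
  have := vBE x; rewrite /X connect0 mulr1 v0 add0r => v1.
  apply/rowP => a; rewrite mxE; case: (unliftP 0 a) => [a'|] ->; last exact: v0.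
  by rewrite ord1 -[RHS]v1; congr (v _ _); apply: val_inj.
have MB : M *m B^T = 0.
  apply/matrixP => a b; rewrite !mxE.
  pose p := enum_val a; have pS : p \in S := enum_valP a.
  transitivity (\sum_i sg i * @vert E V R p i * (if b == 0 then 1 else (X (inl p.1))%:R)).
    rewrite [RHS](reindex _ (onW_bij _ (@enum_val_bij _))) /=.
    apply: eq_bigr => c _; rewrite !mxE !vertE -/p.
    case: ifP => _; first by ring.
    have [|_] := boolP (incident p (enum_val c)); last by rewrite !(mul0r, mulr0).
    by rewrite /incident => /orP[]/eqP->; rewrite -?XS //; ring.
  by rewrite -mulr_suml sum_sg_vert mul0r.
have := mulmx0_rank_max MB.
rewrite mxrank_tr (eqP rM) (eqP rB) cS /n card_sum; lia.
Qed.

End Cones.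

(** * Coordinates of a tree center *)

Section Flows.
Local Open Scope ring_scope.
Variables (R : realType) (E V : finType).
Implicit Types (S F A : {set E * V}) (p : E * V) (phi : E * V -> R).
Implicit Types (z : point E V R) (h : E -> nat).

Definition indic A p : R := (p \in A)%:R.

Lemma comb_indic A e : comb (indic A) (inl e) = (degE A e)%:R.
Proof.
rewrite comb_inl /indic /degE -sum1dep_card natr_sum [RHS]big_mkcond.
by apply: eq_bigr => v _; case: ((e, v) \in A).
Qed.

Lemma tree_sep_comb F x y : is_tree F ->
  comb (fun p => ((p \in F) && ~~ connect (adjrel (F :\ p)) x y)%:R) x = (x != y)%:R :> R.
Proof.
move=> tF; rewrite -(tree_sep_card x y tF) -sum1dep_card natr_sum [RHS]big_mkcond.
apply: eq_bigr => p _; rewrite vertE.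
by case: (p \in F); case: (incident p x); case: (connect _ _ _) => /=; ring.
Qed.

(* The denominator [|E|] keeps this point off all walls: the [E]-part of a component cut off by an
   edge is a proper subset of [E], so its mass is an integer only if that part is empty. *)
Definition tree_center h z :=
  (forall e, z (inl e) = (h e)%:R + (#|E|%:R)^-1) /\ (forall v, z (inr v) = 1).

(** On an edge [p] of [F] this is the fraction of [E] that lies on the side of [p.1]; it is positive
    because [p.1] itself counts. *)
Definition tree_weight F p : R :=
  \sum_e ((p \in F) && connect (adjrel (F :\ p)) (inl p.1) (inl e))%:R / #|E|%:R.

Lemma comb_sum (I : finType) (l : I -> E * V -> R) i :
  comb (fun p => \sum_j l j p) i = \sum_j comb (l j) i.
Proof.
rewrite /comb exchange_big; apply: eq_bigr => p _.
by rewrite mulr_suml.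
Qed.

Lemma comb_scale (a : R) phi i : comb (fun p => phi p * a) i = comb phi i * a.
Proof. by rewrite /comb mulr_suml; apply: eq_bigr => p _; rewrite mulrAC. Qed.

Lemma eq_comb_incident phi psi i : (forall p, incident p i -> phi p = psi p) ->
  comb phi i = comb psi i.
Proof.
move=> h; apply: eq_bigr => p _; rewrite vertE.
by have [/h ->|] := boolP (incident p i); rewrite ?mulr0.
Qed.

Lemma tree_weight_supported F : supported F (tree_weight F).
Proof. by move=> p /negbTE pF; rewrite /tree_weight big1 // => e _; rewrite pF mul0r. Qed.

Lemma tree_weight_gt0 F p : p \in F -> 0 < tree_weight F p.
Proof.
move=> pF; have m0 : 0 < #|E|%:R :> R by rewrite ltr0n; apply/card_gt0P; exists p.1.
rewrite /tree_weight (bigD1 p.1) //= pF connect0 ltr_pwDl ?divr_gt0 ?ltr01 //.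
by apply: sumr_ge0 => e _; rewrite mulr_ge0 ?invr_ge0 ?ler0n // ltW.
Qed.

(** Fix one target hyperedge, then average. At [v] only the first edge toward the target counts,
    giving 1; at [e] all edges but the first one toward the target count, giving [h e], or [h e + 1]
    if the target is [e]. *)
Lemma tree_weight_center F h : is_tree F -> (0 < #|E|)%N -> (forall e, degE F e = (h e).+1) ->
  tree_center h (comb (tree_weight F)).
Proof.
move=> tF E0 dF; have m0 : #|E|%:R != 0 :> R by rewrite pnatr_eq0 -lt0n.
split=> [e|v]; rewrite /tree_weight comb_sum; under eq_bigr do rewrite comb_scale.
  transitivity (\sum_e' ((degE F e)%:R - (inl e != inl e' :> E + V)%:R) / #|E|%:R : R).
    apply: eq_bigr => e' _; congr (_ / _).
    have -> : (degE F e)%:R - (inl e != inl e' :> E + V)%:R = comb (fun p => 1 * indic F p + (-1) *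
        ((p \in F) && ~~ connect (adjrel (F :\ p)) (inl e) (inl e'))%:R) (inl e) :> R.
      by rewrite comb_lin comb_indic tree_sep_comb //; ring.
    apply: eq_comb_incident => p.
    rewrite /incident orbF /indic => /eqP->.
    by case: (p \in F); case: (connect _ _ _) => /=; ring.
  transitivity (\sum_e' ((h e)%:R / #|E|%:R + (e == e')%:R / #|E|%:R) : R).
    apply: eq_bigr => e' _; rewrite dF -mulrDl; congr (_ / _).
    have -> : (inl e != inl e' :> E + V) = (e != e') by [].
    by rewrite -natr1; case: (e == e') => /=; ring.
  rewrite big_split /= sumr_const (bigD1 e) //= eqxx big1 => [|e' /negbTE ne].
    by rewrite -[X in X + _]mulr_natr divfK // addr0 mul1r.
  by rewrite eq_sym ne mul0r.
transitivity (\sum_(e : E) (#|E|%:R)^-1 : R); last by rewrite sumr_const -[LHS]mulr_natr mulVf.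
apply: eq_bigr => e _; rewrite -[RHS]mul1r; congr (_ * _).
rewrite -[RHS](tree_sep_comb (inr v) (inl e) tF); apply: eq_comb_incident => p.
rewrite /incident /= => /eqP->; congr (nat_of_bool _)%:R.
by case pF: (p \in F); rewrite ?andFb // tree_sides.
Qed.

Lemma mass_tree_center h phi : tree_center h (comb phi) -> mass (comb phi) = #|V|%:R.
Proof.
move=> [_ zv]; rewrite mass_comb -sum1_card natr_sum.
rewrite -(eq_bigr _ (fun v _ => zv v)) (eq_bigr _ (fun v _ => comb_inr phi v)).
by rewrite exchange_big pair_bigA; apply: eq_bigr => -[].
Qed.

(** The mass of the tree center is [\sum_e f e + 1] when summed over [E] and [#|V|] when summed over
    [V]. *)
Lemma hypertree_sum (G : {set E * V}) (f : E -> nat) : (0 < #|E|)%N -> hypertree G f -> (\sum_e f e).+1%N = #|V|.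
Proof.
move=> E0 /hypertreeP[F /andP[_ tF] dF]; have zc := tree_weight_center tF E0 dF.
apply/eqP; rewrite -(eqr_nat R) -(mass_tree_center zc) /mass.
rewrite (eq_bigr _ (fun e _ => zc.1 e)) big_split /= -natr_sum sumr_const -natr1.
apply/eqP; congr (_ + _).
by rewrite -[RHS]mulr_natr mulVf // pnatr_eq0 -lt0n.
Qed.

Lemma center_tree_coord_neq0 S h z p : is_tree S -> p \in S -> tree_center h z ->
  tree_coord S z p != 0.
Proof.
move=> tS pS [ze zv]; pose C i := connect (adjrel (S :\ p)) (inr p.2) i.
have E0 : (0 < #|E|)%N by apply/card_gt0P; exists p.1.
have m0 : #|E|%:R != 0 :> R by rewrite pnatr_eq0 -lt0n.
pose a := #|[set v | C (inr v)]|; pose b := #|[set e | C (inl e)]|.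
pose s := (\sum_(e | C (inl e)) h e)%N.
have -> : tree_coord S z p = a%:R - s%:R - b%:R / #|E|%:R.
  rewrite /tree_coord pS big_sumType /= -/C.
  rewrite [X in X + _](eq_bigr (fun e => - (h e)%:R - (#|E|%:R)^-1)); last by move=> e _; rewrite ze; ring.
  rewrite [X in _ + X](eq_bigr (fun=> 1)); last by move=> v _; rewrite zv mulr1.
  rewrite sumrB sumrN -natr_sum -/s.
  have -> : \sum_(v | C (inr v)) 1 = a%:R :> R by rewrite /a -sum1dep_card natr_sum.
  have -> : \sum_(e | C (inl e)) (#|E|%:R)^-1 = b%:R / #|E|%:R :> R.
    by rewrite sumr_const /b cardsE mulr_natl.
  ring.
have bE : (b < #|E|)%N.
  rewrite /b -cardsT; apply: proper_card; apply/properP; split; first exact: subsetT.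
  by exists p.1; rewrite ?inE // /C -tree_sides // connect0.
have a0 : (0 < a)%N by apply/card_gt0P; exists p.2; rewrite inE /C connect0.
(* A vanishing coordinate makes [#|E|] divide [b < #|E|], so [b] is 0; then [s] is 0 as well, and
   [a] cannot be positive. *)
apply/eqP => eq0; have : (a * #|E| = s * #|E| + b)%N.
  apply/eqP; rewrite -(eqr_nat R) natrD !natrM -subr_eq0; apply/eqP.
  by rewrite -[RHS](mul0r #|E|%:R) -eq0; field.
move=> eqn; have b0 : b = 0%N.
  have : b = (b %% #|E|)%N by rewrite modn_small.
  have -> : b = (a * #|E| - s * #|E|)%N by rewrite eqn addKn.
  by rewrite -mulnBl modnMl.
have s0 : s = 0%N.
  rewrite /s big1 // => e eC; have /eqP := b0; rewrite cards_eq0 => /eqP/setP/(_ e).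
  by rewrite !inE eC.
by move: eqn; rewrite b0 s0 addn0 mul0n => /eqP; rewrite muln_eq0; lia.
Qed.

(** Every coordinate is at most 1, since each [v] receives 1 in all; so a total above [h e] needs
    more than [h e] edges at [e]. *)
Lemma nonneg_center_degree S phi h z e : supported S phi -> (forall p, 0 <= phi p) ->
  comb phi =1 z -> tree_center h z -> (h e < degE S e)%N.
Proof.
move=> sphi phi0 cz [ze zv].
have E0 : 0 < #|E|%:R :> R by rewrite ltr0n; apply/card_gt0P; exists e.
rewrite -(ltr_nat R) -comb_indic comb_inl.
apply: (@lt_le_trans _ _ (z (inl e))); first by rewrite ze ltrDl invr_gt0.
rewrite -cz comb_inl; apply: ler_sum => v _; rewrite /indic.
have [_|/sphi->] := boolP ((e, v) \in S); last exact: ler0n.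
by rewrite -(zv v) -cz comb_inr (bigD1 e) //= lerDl sumr_ge0.
Qed.

(* Otherwise sum the balance equations over all [e] with an incoming flow: everything they send
   out is absorbed by at most as many [v] as there are positive edges, each consuming [1]. *)
Lemma negative_edge_degree phi h z : comb phi =1 z -> tree_center h z ->
    (exists p, phi p < 0) ->
  exists2 p, phi p < 0 & (h p.1 < degE [set q | 0 < phi q]%R p.1)%N.
Proof.
move=> cz [ze zv] [p0 p0n]; apply: contrapT => no.
pose P := [set q | 0 < phi q]; pose X := [set e | [exists v, phi (e, v) < 0]].
have E0 : 0 < #|E|%:R :> R by rewrite ltr0n; apply/card_gt0P; exists p0.1.
have degX e : e \in X -> (degE P e <= h e)%N.
  rewrite inE => /existsP[v ev]; rewrite leqNgt; apply/negP => lt.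
  by apply: no; exists (e, v).
pose pp q := if 0 < phi q then phi q else 0.
pose nn q := if phi q < 0 then - phi q else 0.
have phiE q : phi q = pp q - nn q.
  by rewrite /pp /nn; case: ltrgtP => // [_|_|<-]; ring.
have pp0 q : 0 <= pp q by rewrite /pp; case: ltrgtP => // /ltW.
have nn0 q : 0 <= nn q by rewrite /nn; case: ltrgtP => //; rewrite oppr_ge0 => /ltW.
have nnX e v : e \notin X -> nn (e, v) = 0.
  by rewrite inE negb_exists => /forallP/(_ v)/negbTE; rewrite /nn => ->.
(* A hyperedge in [X] sends out what it receives plus [h e] plus the inverse of [#|E|], and [h e]
   bounds its number of positive edges. *)
have le1 : \sum_(e in X) (\sum_v (indic P (e, v) + nn (e, v)) + (#|E|%:R)^-1) <=
           \sum_(e in X) \sum_v pp (e, v).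
  apply: ler_sum => e eX; rewrite big_split /= -comb_inl comb_indic.
  have : \sum_v pp (e, v) - \sum_v nn (e, v) = (h e)%:R + (#|E|%:R)^-1.
    by rewrite -ze -cz comb_inl -sumrB; apply: eq_bigr => v _; rewrite phiE.
  have : (degE P e)%:R <= (h e)%:R :> R by rewrite ler_nat degX.
  lra.
(* A node [v] reached from [X] by a positive edge absorbs 1, covered by the indicator of that edge,
   and returns the rest along negative edges, which all end in [X]. *)
have le2 : \sum_(e in X) \sum_v pp (e, v) <= \sum_(e in X) \sum_v (indic P (e, v) + nn (e, v)).
  rewrite exchange_big [leRHS]exchange_big /=; apply: ler_sum => v _; rewrite big_split /=.
  have [/existsP[e /andP[eX eP]]|none] := boolP [exists e, (e \in X) && ((e, v) \in P)].
    have s1 : \sum_e pp (e, v) - \sum_e nn (e, v) = 1.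
      by rewrite -(zv v) -cz comb_inr -sumrB; apply: eq_bigr => e' _; rewrite phiE.
    have s2 : \sum_e nn (e, v) = \sum_(e in X) nn (e, v).
      rewrite [LHS](bigID (mem X)) /= [X in _ + X]big1 ?addr0 // => e' /nnX; exact.
    have s3 : \sum_(e in X) pp (e, v) <= \sum_e pp (e, v).
      by rewrite [leRHS](bigID (mem X)) /= lerDl sumr_ge0.
    have s4 : 1 <= \sum_(e in X) indic P (e, v).
      by rewrite (bigD1 e) //= /indic eP lerDl sumr_ge0 // => *; apply: ler0n.
    lra.
  rewrite big1 => [|e eX].
    by rewrite addr_ge0 ?sumr_ge0 // => *; rewrite ?ler0n.
  move: none; rewrite negb_exists => /forallP/(_ e); rewrite eX inE /= => /negbTE.
  by rewrite /pp => ->.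
have X0 : 0 < \sum_(e in X) (#|E|%:R)^-1 :> R.
  rewrite (bigD1 p0.1) /=; last by rewrite inE; apply/existsP; exists p0.2; rewrite -surjective_pairing.
  by rewrite ltr_pwDl ?invr_gt0 // sumr_ge0 // => *; rewrite invr_ge0 ltW.
have := le_trans le1 le2; rewrite big_split /=; lra.
Qed.

Lemma dot_vert (c : point E V R) p :
  \sum_i c i * @vert E V R p i = c (inl p.1) + c (inr p.2).
Proof.
rewrite big_sumType /= (bigD1 p.1) //= (bigD1 p.2) //= !eqxx !big1 => [|v /negbTE->|e /negbTE->];
  by rewrite ?mulr0 ?mulr1 ?addr0.
Qed.

Lemma dot_comb (c : point E V R) phi :
  \sum_i c i * comb phi i = \sum_p phi p * (c (inl p.1) + c (inr p.2)).
Proof.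
under eq_bigr do rewrite /comb mulr_sumr.
rewrite exchange_big; apply: eq_bigr => p _; rewrite -dot_vert mulr_sumr.
by apply: eq_bigr => i _; rewrite mulrCA.
Qed.

End Flows.

(** * Triangulations *)

Section Small.
Local Open Scope ring_scope.
Variable R : realType.

(** Such properties are closed under finite conjunctions, so that a single [eps] serves all
    simplices and edges at once. *)
Definition small (P : R -> Prop) := exists2 e, 0 < e & forall eps, 0 < eps -> eps <= e -> P eps.

Lemma small_and (P Q : R -> Prop) : small P -> small Q -> small (fun e => P e /\ Q e).
Proof.
move=> [a a0 hP] [b b0 hQ]; exists (Num.min a b); first by rewrite lt_min a0.
by move=> e e0; rewrite le_min => /andP[ea eb]; split; [apply: hP | apply: hQ].
Qed.

Lemma small_sub (P Q : R -> Prop) : (forall e, 0 < e -> P e -> Q e) -> small P -> small Q.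
Proof. by move=> h [a a0 hP]; exists a => // e e0 ea; apply: h (hP _ e0 ea). Qed.

Lemma small_true (P : R -> Prop) : (forall e, 0 < e -> P e) -> small P.
Proof. by move=> h; exists 1 => // e /h. Qed.

Lemma small_forall (I : finType) (P : I -> R -> Prop) :
  (forall i, small (P i)) -> small (fun e => forall i, P i e).
Proof.
move=> h; have : small (fun e => forall i, i \in enum I -> P i e).
  elim: (enum I) => [|i s IH]; first by apply: small_true.
  apply: small_sub (small_and (h i) IH) => e _ [Pi Ps] j.
  by rewrite inE => /orP[/eqP->|/Ps].
by apply: small_sub => e _ H i; apply: H; rewrite mem_enum.
Qed.

Lemma small_exists (P : R -> Prop) : small P -> exists2 e, 0 < e & P e.
Proof. by move=> [a a0 h]; exists a => //; apply: h. Qed.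

Lemma small_pos (a b : R) : 0 < a -> small (fun e => 0 < a - e * b).
Proof.
move=> a0; exists (a / (`|b| + 1)); first by rewrite divr_gt0 ?ltr_pwDr.
move=> e e0; rewrite ler_pdivlMr; last by rewrite ltr_pwDr. rewrite mulrDr mulr1 => le.
have : e * b <= e * `|b| by rewrite ler_wpM2l ?ler_norm // ltW.
lra.
Qed.

End Small.

Section Triangulation.
Local Open Scope ring_scope.
Variables (R : realType) (E V : finType) (G : {set E * V}) (T : {set {set E * V}}).
Hypotheses (E0 : (0 < #|E|)%N) (V0 : (0 < #|V|)%N) (Gc : connectedb G).
Hypothesis Ttri : is_triangulation R G T.
Implicit Types (S A : {set E * V}) (p : E * V) (lam : E * V -> R) (x : point E V R).

Lemma simplex_aff_indep S : S \in T -> @aff_indep E V R S.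
Proof. by case: Ttri => h _ _ /h[]. Qed.

Lemma simplex_subset S : S \in T -> S \subset G.
Proof. by case: Ttri => h _ _ /h[]. Qed.

Lemma simplex_card S : S \in T -> #|S| = (#|E| + #|V|).-1.
Proof. by case: Ttri => h _ _ /h[]. Qed.

Lemma simplex_tree S : S \in T -> is_tree S.
Proof.
move=> ST; have ai := simplex_aff_indep ST; apply/andP; split.
  exact: aff_indep_connected ai (simplex_card ST) E0.
by apply/forall_inP => p; apply: aff_indep_bridge ai.
Qed.

Lemma cone_cover x : in_cone G x -> 0 < mass x -> exists2 S, S \in T & in_cone S x.
Proof.
move=> xG m0; have := in_cone_conv xG m0; case: Ttri => _ _ h /h[S ST /in_convE[xS _]].
exists S => //; apply: (@in_cone_scale _ _ _ S (fun i => (mass x)^-1 * x i) x (mass x)) => //.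
  exact: ltW.
by move=> i; rewrite mulVKf // gt_eqF.
Qed.

(** Up to scaling, the point lies in the common face of the two simplices; since its coordinates on
    [S1] are unique, they are carried by that face. *)
Lemma cone_support_sub S1 S2 lam p : S1 \in T -> S2 \in T -> supported S1 lam ->
  (forall q, 0 <= lam q) -> in_cone S2 (comb lam) -> 0 < lam p -> p \in S2.
Proof.
move=> S1T S2T sl l0 c2 lp; have m0 : 0 < mass (comb lam).
  by rewrite mass_comb (bigD1 p) //= ltr_pwDl // sumr_ge0.
have c1 : in_cone S1 (comb lam) by exists lam.
case: Ttri => _ h _; have [A [/subsetP AS hA]] := h _ _ S1T S2T.
have /hA/in_convE[[mu [mu0 ms mx]] _] := conj (in_cone_conv c1 m0) (in_cone_conv c2 m0).
have sm : supported S1 (fun q => mu q * mass (comb lam)).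
  move=> q qS; rewrite ms ?mul0r //; apply: contra qS => /AS.
  by rewrite inE => /andP[].
have /(_ p) lm : lam =1 (fun q => mu q * mass (comb lam)).
  apply: comb_inj (simplex_aff_indep S1T) sl sm _ => i.
  by rewrite comb_scale -mx mulrAC mulVf ?mul1r // gt_eqF.
have pA : p \in A by apply: contraTT lp => /ms; rewrite lm => ->; rewrite mul0r ltxx.
by have := AS p pA; rewrite inE => /andP[].
Qed.

Lemma positive_simplex_unique S1 S2 lam1 lam2 : S1 \in T -> S2 \in T ->
  supported S1 lam1 -> supported S2 lam2 ->
  (forall p, p \in S1 -> 0 < lam1 p) -> (forall p, p \in S2 -> 0 < lam2 p) ->
  comb lam1 =1 comb lam2 -> S1 = S2.
Proof.
move=> S1T S2T s1 s2 p1 p2 eq12.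
have nn S lam q : supported S lam -> (forall p, p \in S -> 0 < lam p) -> 0 <= lam q.
  by move=> sl pl; have [/pl/ltW|/sl->] := boolP (q \in S).
apply/eqP; rewrite eqEsubset; apply/andP; split; apply/subsetP => p pS.
  apply: (@cone_support_sub S1 S2 lam1) => //; last exact: p1.
    by move=> q; apply: nn s1 p1.
  by exists lam2; split=> // q; apply: nn s2 p2.
apply: (@cone_support_sub S2 S1 lam2) => //; last exact: p2.
  by move=> q; apply: nn s2 p2.
by exists lam1; split=> // q; apply: nn s1 p1.
Qed.

(* The signed indicator of a proper set closed under [residual A] is a supporting functional of the
   polytope that vanishes on [A]. *)
Definition residual A : rel (E + V) := fun i j =>
  match i, j with
  | inl e, inr v => (e, v) \in G
  | inr v, inl e => (e, v) \in A
  | _, _ => false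
  end.

Lemma interior_residual_connect A (a b : E + V) : A \subset G ->
  interior_simplex R G A -> connect (residual A) a b.
Proof.
move=> AG iA; apply: contrapT => nab; apply: iA => x /in_convE[xA mx].
pose X i := connect (residual A) a i.
have XG p : p \in G -> X (inl p.1) -> X (inr p.2).
  by case: p => e v pG h; apply: connect_trans h (connect1 _).
have XA p : p \in A -> X (inr p.2) -> X (inl p.1).
  by case: p => e v pA h; apply: connect_trans h (connect1 _).
pose c : point E V R := fun i => - sg R i * (X i)%:R.
split; first by apply/in_convE; split=> //; apply: in_cone_sub xA.
exists c, 0.
have cG p : p \in G -> c (inl p.1) + c (inr p.2) <= 0.
  rewrite /c /= => /XG; case: (X (inl _)) => [->//|_] /=; first by lra.
  by case: (X (inr _)) => /=; lra.
split.
- move=> y /in_convE[[mu [mu0 ms my]] _].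
  under eq_bigr do rewrite my.
  rewrite dot_comb; apply: sumr_le0 => p _; have [/cG h|/ms->] := boolP (p \in G).
    by rewrite mulr_ge0_le0.
  by rewrite mul0r.
- case: xA => mu [mu0 ms my]; under eq_bigr do rewrite my.
  rewrite dot_comb big1 // => p _; have [pA|/ms->] := boolP (p \in A); last by rewrite mul0r.
  rewrite (_ : c _ + c _ = 0) ?mulr0 // /c /=.
  have -> : X (inr p.2) = X (inl p.1).
    by apply/idP/idP => [/XA->//|/XG->//]; apply: (subsetP AG).
  by ring.
(* As [G] is connected, some edge of [G] has only its [V]-end in [X]; there the functional is
   negative, hence it is not constant. *)
- have [p pG np] : exists2 p, p \in G & X (inr p.2) && ~~ X (inl p.1).
    apply: contrapT => no; apply: nab.
    have /forallP/(_ a)/forallP/(_ b) := Gc.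
    apply: (@connect_closed_ind _ _ X) => [|i j Xi /adjrelP[p pG hp]]; first exact: connect0.
    have : X (inl p.1) = X (inr p.2).
      apply/idP/idP => [/XG->//|h]; apply: contrapT => /negP h'.
      by apply: no; exists p => //; rewrite h.
    by case: hp Xi => -[-> ->] => [? <-|? ->].
  exists (@vert E V R p); split.
    apply/in_convE; split; first exact: in_cone_vert.
    rewrite -[LHS](eq_mass (comb_vert R p)) mass_comb (bigD1 p) //= eqxx big1 ?addr0 //.
    by move=> q /negbTE->.
  rewrite dot_vert /c /=; case/andP: np => -> /negbTE-> /=; lra.
Qed.

(** Follow a residual walk from [p.2] back to [p.1]. Edges of [G] are added; each edge of [A]
    traversed backwards is subtracted, which one more copy of [indic A] pays for. *)
Lemma interior_cone_vert A p : A \subset G -> interior_simplex R G A -> p \in G ->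
  exists2 a, 0 <= a & in_cone G (fun i => a * comb (indic R A) i - @vert E V R p i).
Proof.
move=> AG iA pG; have := interior_residual_connect (inr p.2) (inl p.1) AG iA.
suff H (j : E + V) : connect (residual A) (inr p.2) j -> exists2 a, 0 <= a &
    in_cone G (fun i => a * comb (indic R A) i + sdelta R j i - sdelta R (inr p.2) i).
  move=> /H[a a0 ha]; exists a => //.
  by apply: (in_cone_scale (a := 1)) ha => // i; rewrite vert_sdelta; ring.
apply: (@connect_closed_ind _ _ (fun j => exists2 a, 0 <= a &
    in_cone G (fun i => a * comb (indic R A) i + sdelta R j i - sdelta R (inr p.2) i))).
  exists 0 => //; exists (fun=> 0); split=> // i.
  by rewrite /comb [RHS]big1 => [|q _]; [ring | rewrite mul0r].
move=> i k [a a0 ha]; case: i k ha => [e|v] [e'|v'] //= ha hG.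
  exists a => //; apply: in_coneD ha (in_cone_vert R hG) => i.
  by rewrite (vert_sdelta R (e, v')) /=; ring.
exists (a + 1); first by rewrite addr_ge0.
have hA : in_cone G (fun i => comb (indic R A) i - @vert E V R (e', v) i).
  exists (fun q => 1 * indic R A q + (-1) * (q == (e', v))%:R); split=> [q|q qG|i].
  - rewrite /indic; case: eqVneq => [->|_]; first by rewrite hG /=; lra.
    by case: (q \in A) => /=; lra.
  - rewrite /indic; case: eqVneq => [qe|_]; first by rewrite qe (subsetP AG) in qG.
    by rewrite (negbTE (contra (subsetP AG q) qG)) /=; ring.
  - by rewrite comb_lin comb_vert; ring.
by apply: in_coneD ha hA => i; rewrite (vert_sdelta R (e', v)) /=; ring.
Qed.

Lemma interior_cone_sub A lam : A \subset G -> interior_simplex R G A ->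
  supported G lam -> (forall p, 0 <= lam p) ->
  small (fun eps => in_cone G (fun i => comb (indic R A) i - eps * comb lam i)).
Proof.
move=> AG iA sl l0.
have [a a0 ha] : exists2 a, 0 <= a &
    in_cone G (fun i => a * comb (indic R A) i - comb lam i).
  suff H s : exists2 a, 0 <= a & in_cone G
      (fun i => a * comb (indic R A) i - \sum_(p <- s) lam p * @vert E V R p i).
    exact: H.
  elim: s => [|p s [a a0 ha]].
    exists 0 => //; exists (fun=> 0); split=> // i.
    by rewrite big_nil /comb [RHS]big1 => [|q _]; [ring | rewrite mul0r].
  have [pG|pG] := boolP (p \in G); last first.
    exists a => //; apply: (in_cone_scale (a := 1)) ha => // i.
    by rewrite [in LHS]big_cons sl // mul0r add0r mul1r.
  have [b b0 hb] := interior_cone_vert AG iA pG.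
  exists (a + lam p * b); first by rewrite addr_ge0 ?mulr_ge0.
  apply: in_coneD ha (in_cone_scale (l0 p) (fun i => erefl) hb) => i.
  by rewrite big_cons; ring.
(* Up to [comb], the point is [(1 - e * a) * indic A + e * (a * indic A - lam)]; this bound on [e]
   keeps the first factor nonnegative. *)
exists (1 + a)^-1; first by rewrite invr_gt0 ltr_pwDl.
move=> e e0 ea; have hA : in_cone G (comb (indic R A)).
  exists (indic R A); split=> // p pG.
  by rewrite /indic (negbTE (contra (subsetP AG p) pG)).
have le1 : 0 <= 1 - e * a.
  have : e * (1 + a) <= 1 by rewrite -ler_pdivlMr ?mul1r ?ltr_pwDl.
  lra.
have h1 := in_cone_scale (ltW e0) (fun i => erefl) ha.
have h2 := in_cone_scale le1 (fun i => erefl) hA.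
by apply: in_coneD h1 h2 => i; ring.
Qed.

End Triangulation.

(** * Half-open decomposition seen from a tree center *)

Section HalfOpen.
Local Open Scope ring_scope.
Variables (R : realType) (E V : finType) (G : {set E * V}) (T : {set {set E * V}}).
Hypotheses (E0 : (0 < #|E|)%N) (V0 : (0 < #|V|)%N) (Gc : connectedb G).
Hypothesis Ttri : is_triangulation R G T.
Variables (h : E -> nat) (F : {set E * V}).
Hypotheses (tF : spanning_tree G F) (dF : forall e, degE F e = (h e).+1).
Implicit Types (S A : {set E * V}) (p : E * V).

Let w := tree_weight R F.
Let z : point E V R := comb w.
Let phi S := tree_coord S z.
Let neg S := [set p in S | phi S p < 0].

Let treeF : is_tree F. Proof. by case/andP: tF. Qed.
Let FG : F \subset G. Proof. by case/andP: tF. Qed.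

Let zc : tree_center h z. Proof. exact: tree_weight_center. Qed.

Let w_ge0 p : 0 <= w p.
Proof.
have [/(tree_weight_gt0 R)/ltW //|/(tree_weight_supported R)] := boolP (p \in F).
by rewrite /w => ->.
Qed.

Let w_supp : supported G w.
Proof. by move=> p pG; apply: tree_weight_supported; apply: contra (subsetP FG p) pG. Qed.

Let mass_z : mass z = #|V|%:R. Proof. exact: mass_tree_center zc. Qed.

Let phi_comb S : S \in T -> comb (phi S) =1 z.
Proof.
by move=> ST; apply: tree_coord_comb (sum_sg_comb _); apply: (simplex_tree E0 Ttri).
Qed.

Let phi_supp S : supported S (phi S). Proof. exact: tree_coord_supported. Qed.

Let phi_neq0 S p : S \in T -> p \in S -> phi S p != 0.
Proof. move=> ST pS; apply: center_tree_coord_neq0 zc => //; exact: (simplex_tree E0 Ttri). Qed.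

Let shift_comb S A (eps : R) : S \in T ->
  comb (fun p => 1 * indic R A p + (- eps) * phi S p) =1
  (fun i => comb (indic R A) i - eps * z i).
Proof. by move=> ST i; rewrite comb_lin phi_comb // mul1r mulNr. Qed.

Let indic_supp S A : A \subset S -> supported S (indic R A).
Proof. by move=> /subsetP AS p pS; rewrite /indic (negbTE (contra (AS p) pS)). Qed.

Let shift_supp S A (eps : R) : A \subset S ->
  supported S (fun p => 1 * indic R A p + (- eps) * phi S p).
Proof. by move=> AS p pS; rewrite (indic_supp AS pS) phi_supp //; ring. Qed.

(** An edge of [A] has coordinate near 1; an edge of [S] outside [A] lies in [neg S], so subtracting
    [eps * phi S p] makes its coordinate positive. *)
Let shift_pos S A : S \in T -> A \subset S -> S :\: neg S \subset A ->
  small (fun eps => forall p, p \in S -> 0 < 1 * indic R A p + (- eps) * phi S p).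
Proof.
move=> ST AS /subsetP SA; apply: small_forall => p.
have [pA|pA] := boolP (p \in A).
  apply: small_sub (small_pos (phi S p) (ltr01 : 0 < 1 :> R)) => e e0 h0 _.
  by rewrite /indic pA /=; move: h0; lra.
apply: small_true => e e0 pS.
have : p \in neg S by apply: contraNT pA => pn; apply: SA; rewrite inE pn.
rewrite inE => /andP[_ n0]; rewrite /indic (negbTE pA) /= mulr0 add0r mulNr -mulrN.
by rewrite mulr_gt0 // oppr_gt0.
Qed.

(** For small [e] the point [comb (indic A) - e * z] is interior to the cones over both
    simplices. *)
Lemma between_unique S1 S2 A : S1 \in T -> S2 \in T ->
  A \subset S1 -> S1 :\: neg S1 \subset A -> A \subset S2 -> S2 :\: neg S2 \subset A ->
  S1 = S2.
Proof.
move=> S1T S2T A1 n1 A2 n2.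
have [e e0 [p1 p2]] := small_exists (small_and (shift_pos S1T A1 n1) (shift_pos S2T A2 n2)).
apply: (positive_simplex_unique Ttri S1T S2T (shift_supp e A1) (shift_supp e A2) p1 p2).
by move=> i; rewrite !shift_comb.
Qed.

(** As [A] is interior, the point pushed away from [z] stays in the cone over [G], hence lies over
    some [S]. For small [e] its coordinates on [S] can be nonnegative only if those of [indic A]
    are, with ties decided by [phi S]; this forces [A \subset S] and the sign condition outside
    [A]. *)
Lemma between_exists A : simplex_of T A -> interior_simplex R G A ->
  exists2 S, S \in T & (A \subset S) && (S :\: neg S \subset A).
Proof.
move=> /exists_inP[S0 S0T AS0] iA.
have AG : A \subset G := subset_trans AS0 (simplex_subset Ttri S0T).
(* The empty set is not interior: its convex hull is empty, so it lies in the boundary. *)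
have A0 : 0 < #|A|%:R :> R.
  rewrite ltr0n lt0n cards_eq0; apply: contra_notN iA => /eqP-> x [lam [_ ls l1 _]].
  move: l1; rewrite big1 => [/eqP|p _]; first by rewrite eq_sym oner_eq0.
  by rewrite ls ?inE.
pose chi S := tree_coord S (comb (indic R A)).
have chi_comb S : S \in T -> comb (chi S) =1 comb (indic R A).
  by move=> ST; apply: tree_coord_comb (sum_sg_comb _); apply: (simplex_tree E0 Ttri).
have massA : mass (comb (indic R A)) = #|A|%:R.
  rewrite mass_comb -sum1_card natr_sum [RHS]big_mkcond; apply: eq_bigr => p _.
  by rewrite /indic; case: (p \in A).
pose good S p := 0 < chi S p \/ chi S p = 0 /\ phi S p < 0.
have sm_good : small (fun eps => forall S p, S \in T -> p \in S ->
    0 <= chi S p - eps * phi S p -> good S p).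
  apply: small_forall => S; apply: small_forall => p.
  rewrite /good; have [chi_gt|chi_lt|chi_eq] := ltrgtP 0 (chi S p).
  - by apply: small_true => e _ _ _ _; left.
  - have : 0 < - chi S p by rewrite oppr_gt0.
    move=> /(small_pos (- phi S p)); apply: small_sub => e _ pos _ _; lra.
  - apply: small_true => e e0 ST pS; rewrite -chi_eq sub0r oppr_ge0 pmulr_rle0 // => le.
    by right; split=> //; rewrite lt_def eq_sym phi_neq0.
have sm_mass := small_pos (mass z) A0.
have [e e0 [[eG eM] eg]] :=
  small_exists (small_and (small_and (interior_cone_sub Gc AG iA w_supp w_ge0) sm_mass) sm_good).
have [|S ST [mu [mu0 ms mx]]] := cone_cover Ttri eG.
  by rewrite /mass sumrB -mulr_sumr -/(mass _) massA.
exists S => //.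
have muE : mu =1 (fun p => 1 * chi S p + (- e) * phi S p).
  apply: (comb_inj (simplex_aff_indep Ttri ST) ms) => [q qS|i].
    by rewrite phi_supp // /chi tree_coord_supported //; ring.
  by rewrite -mx comb_lin chi_comb // phi_comb // mul1r mulNr.
have gd p : p \in S -> good S p.
  move=> pS; apply: eg => //; have := mu0 p; rewrite muE; lra.
have chi0 p : 0 <= chi S p.
  have [/gd[/ltW//|[-> _]]|pS] := boolP (p \in S); first exact: lexx.
  by rewrite /chi tree_coord_supported.
have AS : A \subset S.
  apply/subsetP => p pA; apply: (cone_support_sub Ttri S0T ST (indic_supp AS0)).
  - by move=> q; apply: ler0n.
  - by exists (chi S); split=> // [|i]; [apply: tree_coord_supported | rewrite chi_comb].
  - by rewrite /indic pA ltr01.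
rewrite AS; apply/subsetP => p; rewrite inE => /andP[pn pS]; apply: contraNT pn => pA.
have cA : indic R A =1 chi S.
  apply: (comb_inj (simplex_aff_indep Ttri ST)) => [||i]; first exact: indic_supp.
    exact: tree_coord_supported.
  by rewrite chi_comb.
rewrite inE pS; have := gd p pS; rewrite /good -(cA p) /indic (negbTE pA) ltxx.
by case=> // -[].
Qed.

(** Suppose a supporting functional attains its maximum at the normalized indicator point of [A].
    Since [comb (indic A) - e * z] is in the cone, [z] attains it too after scaling, and so does
    every edge of [F], its weight in [z] being positive. As [F] spans, the functional is constant on
    the polytope. *)
Lemma between_interior S A : S \in T -> A \subset S -> S :\: neg S \subset A ->
  interior_simplex R G A.
Proof.
move=> ST AS nA.
have [e e0 pe] := small_exists (shift_pos ST AS nA).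
pose lam p := 1 * indic R A p + (- e) * phi S p; rewrite -/(lam _) in pe.
have lamE : comb lam =1 (fun i => comb (indic R A) i - e * z i) by apply: shift_comb.
have lam_supp : supported S lam by apply: shift_supp.
have lam0 p : 0 <= lam p by have [/pe/ltW|/lam_supp->] := boolP (p \in S).
have mA0 : 0 < mass (comb (indic R A)).
  have : 0 < mass z by rewrite mass_z ltr0n.
  move/(mulr_gt0 e0); have : 0 <= mass (comb lam) by rewrite mass_comb sumr_ge0.
  rewrite (eq_mass lamE) /mass sumrB -mulr_sumr -!/(mass _); lra.
have cA : in_cone A (comb (indic R A)).
  by exists (indic R A); split=> //; apply: indic_supp.
move=> /(_ _ (in_cone_conv cA mA0))[_ [c [d [le eq [y [yG ylt]]]]]].
have le_vert p : p \in G -> c (inl p.1) + c (inr p.2) <= d.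
  move=> pG; rewrite -dot_vert; apply: le; apply/in_convE; split; first exact: in_cone_vert.
  rewrite -[LHS](eq_mass (comb_vert R p)) mass_comb (bigD1 p) //= eqxx big1 ?addr0 //.
  by move=> q /negbTE->.
have le_comb mu : supported G mu -> (forall p, 0 <= mu p) ->
    \sum_i c i * comb mu i <= d * mass (comb mu).
  move=> sm m0; rewrite dot_comb mass_comb mulr_sumr; apply: ler_sum => p _.
  rewrite mulrC; have [/le_vert h1|/sm->] := boolP (p \in G); last by rewrite !mulr0.
  by rewrite ler_wpM2r.
have lam_G : supported G lam.
  by move=> p pG; apply: lam_supp; apply: contra pG; apply: (subsetP (simplex_subset Ttri ST)).
have eqA : \sum_i c i * comb (indic R A) i = d * mass (comb (indic R A)).
  rewrite -eq mulr_suml; apply: eq_bigr => i _.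
  by rewrite -mulrA mulrAC mulVf ?mul1r // gt_eqF.
have gez : d * mass z <= \sum_i c i * z i.
  have := le_comb _ lam_G lam0.
  rewrite (eq_mass lamE) (eq_bigr _ (fun i _ => congr1 (fun t => c i * t) (lamE i))).
  rewrite /mass sumrB -mulr_sumr -!/(mass _).
  have -> : \sum_i c i * (comb (indic R A) i - e * z i) =
      \sum_i c i * comb (indic R A) i - e * \sum_i c i * z i.
    by rewrite mulr_sumr -sumrB; apply: eq_bigr => i _; ring.
  rewrite eqA -/(mass _) mulrBr lerD2l lerN2 mulrCA.
  by rewrite ler_pM2l.
have eqF p : p \in F -> c (inl p.1) + c (inr p.2) = d.
  move=> pF; pose D q := w q * (d - (c (inl q.1) + c (inr q.2))).
  have D0 q : true -> 0 <= D q.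
    move=> _; rewrite /D; have [/le_vert h1|/w_supp->] := boolP (q \in G).
      by rewrite mulr_ge0 // subr_ge0.
    by rewrite mul0r.
  have sD : \sum_q D q = 0.
    apply/eqP; rewrite eq_le sumr_ge0 // andbT; move: gez.
    rewrite /z dot_comb mass_comb -subr_le0 mulr_sumr -sumrB.
    by rewrite (eq_bigr D) // => q _; rewrite /D; ring.
  have /eqP := psumr_eq0P D0 sD (erefl : xpredT p).
  by rewrite mulf_eq0 gt_eqF ?tree_weight_gt0 //= subr_eq0 => /eqP.
move: ylt; case/in_convE: yG => [[mu [mu0 ms my]] m1].
under eq_bigr do rewrite my.
(* [F] is a spanning tree, so every point of the polytope is a combination of its edges, possibly
   with negative coefficients. *)
have muF : comb mu =1 comb (tree_coord F (comb mu)).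
  by move=> i; rewrite tree_coord_comb ?sum_sg_comb.
under eq_bigr do rewrite muF.
rewrite dot_comb (eq_bigr (fun p => d * tree_coord F (comb mu) p)) => [|p _].
  rewrite -mulr_sumr -mass_comb -(eq_mass muF) -(eq_mass my) m1 mulr1 ltxx //.
have [/eqF->|/(@tree_coord_supported R _ _ F)->] := boolP (p \in F); last by ring.
by rewrite mulrC.
Qed.

Lemma nonneg_simplex_exists : exists2 S, S \in T & neg S = set0.
Proof.
have zG : in_cone G z by exists w.
have mz : 0 < mass z by rewrite mass_z ltr0n.
have [S ST [mu [mu0 ms mx]]] := cone_cover Ttri zG mz.
exists S => //; apply/setP => p; rewrite !inE; apply/negP => /andP[pS].
have -> : phi S p = mu p.
  apply: (comb_inj (simplex_aff_indep Ttri ST) (phi_supp (S := S)) ms) => i.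
  by rewrite phi_comb // mx.
by rewrite ltNge mu0.
Qed.

Lemma nonneg_simplex_unique S1 S2 : S1 \in T -> S2 \in T ->
  neg S1 = set0 -> neg S2 = set0 -> S1 = S2.
Proof.
move=> S1T S2T n1 n2.
have pos S p : S \in T -> neg S = set0 -> p \in S -> 0 < phi S p.
  move=> ST /setP/(_ p) + pS; rewrite !inE pS /= => /negbT; rewrite -leNgt => le.
  by rewrite lt_def le phi_neq0.
apply: (positive_simplex_unique Ttri S1T S2T (phi_supp (S := S1)) (phi_supp (S := S2))).
- by move=> p; apply: pos.
- by move=> p; apply: pos.
- by move=> i; rewrite !phi_comb.
Qed.

Lemma sum_interior_dominated (y : E -> nat) : (forall e, y e <= h e)%N ->
  \sum_(A : {set E * V} | [&& simplex_of T A, `[< interior_simplex R G A >] &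
     [forall e, y e < degE A e]%N]) (-1) ^+ #|A| = (-1) ^+ (#|E| + #|V|).-1 :> int.
Proof.
move=> yh; pose btw S A := (A \subset S) && (S :\: neg S \subset A).
(* Each interior simplex lies between [S :\: neg S] and [S] for exactly one maximal [S], and every
   set in such an interval is interior. *)
transitivity (\sum_(S in T) \sum_(A : {set E * V} | btw S A && [forall e, y e < degE A e]%N)
    (-1) ^+ #|A| : int).
  under [RHS]eq_bigr do rewrite big_mkcond.
  rewrite exchange_big big_mkcond /=; apply: eq_bigr => A _.
  have [dA|_] := boolP [forall e, (y e < degE A e)%N]; last first.
    rewrite !andbF big1 // => S _; by rewrite andbF.
  under eq_bigr do rewrite andbT.
  rewrite andbT; case: ifP => [/andP[sA /asboolP iA]|/negP no].
    have [S ST bS] := between_exists sA iA.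
    rewrite (bigD1 S) //= /btw bS /= big1 ?addr0 // => S' /andP[S'T ne].
    case: ifP => // /andP[A' n']; case/eqP: ne; case/andP: bS => A1 n1.
    exact: between_unique A' n' A1 n1.
  rewrite big1 // => S ST; case: ifP => // /andP[A' n'].
  case: no; apply/andP; split; first by apply/exists_inP; exists S.
  exact/asboolP/(between_interior ST).
have [S0 S0T n0] := nonneg_simplex_exists.
rewrite (bigD1 S0) //= [X in _ + X]big1 ?addr0 => [|S /andP[ST ne]].
  (* The interval of [S0] consists of [S0] alone, and [nonneg_center_degree] gives its degree
     condition. *)
  rewrite (big_pred1 S0) ?(simplex_card Ttri) // => A.
  rewrite /btw n0 setD0 -eqEsubset /=; case: eqVneq => [->|] //=.
  apply/forallP => e; apply: leq_ltn_trans (yh e) _.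
  apply: nonneg_center_degree (@phi_supp S0) _ (phi_comb S0T) zc => p.
  have [pS|/phi_supp->//] := boolP (p \in S0).
  by have /setP/(_ p) := n0; rewrite !inE pS /= => /negbT; rewrite -leNgt.
have [p pn] : exists p, phi S p < 0.
  have /set0Pn[p] : neg S != set0.
    apply: contra_neq ne => nS; exact: nonneg_simplex_unique.
  by rewrite inE => /andP[_ ?]; exists p.
have [q qn qd] := negative_edge_degree (phi_comb ST) zc (ex_intro _ p pn).
have qS : q \in S by apply: contraTT qn => /phi_supp->; rewrite ltxx.
(* Toggling [q] stays within the interval because [q] is in [neg S]. The degree condition at [q.1]
   holds anyway: [A] contains all positive edges of [S], more than [h q.1] of them at [q.1]. *)
apply: (@sum_sign_toggle0 _ _ q) => A qA.
have -> : btw S (q |: A) = btw S A.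
  rewrite /btw subUset sub1set qS /=; congr (_ && _).
  apply/idP/idP => [/subsetP sub|sub]; last exact: subset_trans sub (subsetUr _ _).
  apply/subsetP => r rS; have := sub r rS; rewrite !inE => /orP[/eqP rq|//].
  by move: rS; rewrite rq !inE qS qn.
have [/andP[_ /subsetP nA]|//] := boolP (btw S A); rewrite /=.
apply/forallP/forallP => dA e; have := dA e; rewrite degE_setU1 //; last first.
  by move=> lt; rewrite (leq_trans lt) // leq_addr.
case: eqVneq => [-> _|]; last by rewrite addn0.
apply: leq_ltn_trans (yh _) (leq_trans qd _); apply/subset_leq_card/subsetP => v.
rewrite !inE => pv; apply: nA; rewrite !inE negb_and -leNgt (ltW pv) orbT /=.
by apply: contraTT pv => /phi_supp->; rewrite ltxx.
Qed.

End HalfOpen.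

(** * Counting by degree vector *)

Section Counting.
Local Open Scope ring_scope.
Variables (R : realType) (E V : finType) (G : {set E * V}) (T : {set {set E * V}}) (lt : rel E).
Hypotheses (E0 : (0 < #|E|)%N) (V0 : (0 < #|V|)%N) (Gc : connectedb G).
Hypotheses (lt_irr : irreflexive lt) (lt_trans : transitive lt).
Hypothesis lt_total : forall e e', e != e' -> lt e e' || lt e' e.
Hypothesis Ttri : is_triangulation R G T.
Implicit Types (A : {set E * V}) (q : {ffun E -> 'I_#|V|} * {set E}) (g y : {ffun E -> 'I_#|V|}).

Definition interior_face A := simplex_of T A && `[< interior_simplex R G A >].

Lemma degE_pred_lt A e : ((degE A e).-1 < #|V|)%N.
Proof.
by have := max_card [set v | (e, v) \in A]; rewrite -/(degE A e); case: (degE A e).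
Qed.

Lemma sub_mem_lt q e : (q.1 e - (e \in q.2) < #|V|)%N.
Proof. exact: leq_ltn_trans (leq_subr _ _) (ltn_ord _). Qed.

Definition simplex_degree A : {ffun E -> 'I_#|V|} := [ffun e => Ordinal (degE_pred_lt A e)].

Definition pair_degree q : {ffun E -> 'I_#|V|} := [ffun e => Ordinal (sub_mem_lt q e)].

(** A residual walk into [e] must end with an edge of [A], so the degree is positive and the
    predecessor in [simplex_degree] is not truncated. *)
Lemma interior_degE A e : interior_face A -> degE A e = (simplex_degree A e).+1.
Proof.
case/andP=> /exists_inP[S ST AS] /asboolP iA; rewrite ffunE prednK //.
have /card_gt0P[v0 _] := V0; have AG := subset_trans AS (simplex_subset Ttri ST).
suff [v ev] : exists v, (e, v) \in A by apply/card_gt0P; exists v; rewrite inE.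
have := interior_residual_connect Gc (inr v0) (inl e) AG iA.
move=> /(@connect_closed_ind _ _ (fun i => i = inl e -> exists v, (e, v) \in A)).
by apply=> // -[e1|v1] [e2|v2] // _ eA [<-]; exists v1.
Qed.

Lemma card_degE A : #|A| = (\sum_e degE A e)%N.
Proof.
rewrite -sum1_card big_mkcond (eq_bigr (fun p => if (p.1, p.2) \in A then 1 else 0)%N) => [|[] //].
rewrite -(pair_bigA _ (fun e v => if (e, v) \in A then 1 else 0)%N) /=.
apply: eq_bigr => e _; rewrite /degE -sum1_card [RHS]big_mkcond.
by apply: eq_bigr => v _; rewrite inE.
Qed.

Lemma card_interior A : interior_face A -> #|A| = (\sum_e simplex_degree A e + #|E|)%N.
Proof.
move=> iA; rewrite card_degE (eq_bigr _ (fun e _ => interior_degE e iA)).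
by rewrite -[X in (_ + X)%N]sum1_card -big_split /=; apply: eq_bigr => e _; rewrite addn1.
Qed.

(** Hypertrees have total [#|V| - 1], and inactive hyperedges have positive value, so each one in
    [q.2] lowers the total by exactly 1. *)
Lemma pair_degree_sum q : inactive_subset G lt q ->
  (\sum_e pair_degree q e + #|q.2|)%N = #|V|.-1.
Proof.
case/andP=> hq /forall_inP ina; rewrite -[RHS](congr1 predn (hypertree_sum R E0 hq)) /=.
rewrite -[X in (_ + X)%N]sum1_card [X in (_ + X)%N]big_mkcond -big_split /=.
apply: eq_bigr => e _; rewrite ffunE /=; have [eq|_] := boolP (e \in q.2); last by rewrite subn0 addn0.
by have /existsP[e' /and3P[_ f0 _]] := ina e eq; rewrite subnK.
Qed.

Lemma sum_interior y :
  \sum_(A : {set E * V} | [&& simplex_of T A, `[< interior_simplex R G A >] &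
     [forall e, y e < degE A e]%N]) (-1) ^+ #|A| =
  (-1) ^+ (#|E| + #|V|).-1 * (dominated G (fun e => nat_of_ord (y e)))%:R :> int.
Proof.
have [/dominatedP[h /hypertreeP[F tF dF] yh]|ndom] := boolP (dominated _ _).
  by rewrite mulr1; apply: (sum_interior_dominated E0 V0 Gc Ttri tF dF yh).
rewrite mulr0 big1 // => A /and3P[/exists_inP[S ST AS] _ /forallP yA].
case/negP: ndom; apply/dominatedP; exists (fun e => (degE S e).-1) => [|e].
  apply/hypertreeP; exists S => [|e].
    rewrite spanning_treeE (simplex_subset Ttri ST); exact: simplex_tree E0 Ttri _ ST.
  rewrite prednK //; apply: leq_trans (_ : degE A e <= _)%N; first exact: leq_ltn_trans (yA e).
  by apply/subset_leq_card/subsetP => v; rewrite !inE; apply: (subsetP AS).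
have le : (degE A e <= degE S e)%N.
  by apply/subset_leq_card/subsetP => v; rewrite !inE; apply: (subsetP AS).
by have := yA e; lia.
Qed.

(** Up to a global sign, [(-1) ^+ #|A|] and [(-1) ^+ #|q.2|] depend only on the index, so the two
    counts can be compared through signed upper sums, which agree by [sum_interior] and
    [sum_inactive_subset]. *)
Lemma card_interior_degree g :
  #|[set A | interior_face A & simplex_degree A == g]| =
  #|[set q | inactive_subset G lt q & pair_degree q == g]|.
Proof.
pose s g : int := (-1) ^+ (\sum_e g e)%N.
pose N g := #|[set A | interior_face A & simplex_degree A == g]|.
pose M g := #|[set q | inactive_subset G lt q & pair_degree q == g]|.
rewrite -/(N g) -/(M g).
suff : s g * ((N g)%:R - (M g)%:R) = 0.
  move/eqP; rewrite mulf_eq0 signr_eq0 subr_eq0 => /eqP; lia.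
pose c g := s g * ((N g)%:R - (M g)%:R); rewrite -/(c g); apply: upper_sums_eq0 g => y.
have sums (X : finType) (P : pred X) (deg : X -> {ffun E -> 'I_#|V|}) :
    \sum_(g : {ffun E -> 'I_#|V|} | [forall e, y e <= g e]%N)
      s g * (#|[set x | P x & deg x == g]|)%:R =
    \sum_(x | P x && [forall e, y e <= deg x e]%N) s (deg x).
  rewrite [RHS](partition_big deg (fun g => [forall e, y e <= g e]%N)) => [|x /andP[]//].
  apply: eq_bigr => g yg; rewrite -sum1dep_card natr_sum mulr_sumr.
  apply: eq_big => [x|x /andP[_ /eqP->]]; last by rewrite mulr1.
  by rewrite -andbA; congr (_ && _); case: eqVneq => [->|]; rewrite ?yg ?andbF.
rewrite (eq_bigr (fun g => s g * (N g)%:R - s g * (M g)%:R)) => [|g' _]; last by rewrite /c mulrBr.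
rewrite sumrB !sums.
have -> : \sum_(A | interior_face A && [forall e, y e <= simplex_degree A e]%N) s (simplex_degree A) =
    (-1) ^+ #|E| * ((-1) ^+ (#|E| + #|V|).-1 * (dominated G (fun e => nat_of_ord (y e)))%:R).
  rewrite -sum_interior mulr_sumr; apply: eq_big => [A|A /andP[iA _]].
    rewrite andbA -/(interior_face A); case iA: (interior_face A) => //=.
    by apply: eq_forallb => e; rewrite interior_degE.
  by rewrite /s card_interior // exprD mulrCA -expr2 sqrr_sign mulr1.
have -> : \sum_(q | inactive_subset G lt q && [forall e, y e <= pair_degree q e]%N) s (pair_degree q) =
    (-1) ^+ #|V|.-1 * (dominated G (fun e => nat_of_ord (y e)))%:R.
  rewrite -(sum_inactive_subset G lt_irr lt_trans lt_total) mulr_sumr.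
  apply: eq_big => [q|q /andP[iq _]].
    by congr (_ && _); apply: eq_forallb => e; rewrite ffunE.
  by rewrite /s -(pair_degree_sum iq) exprD -mulrA -expr2 sqrr_sign mulr1.
have -> : ((#|E| + #|V|).-1 = #|E| + #|V|.-1)%N by lia.
rewrite exprD -mulrA mulrA -expr2 sqrr_sign mul1r.
exact: subrr.
Qed.

End Counting.

Theorem theorem5p1 (R : realType) (E V : finType) (G : {set E * V})
    (lt : rel E) (T : {set {set E * V}}) (k : nat) :
  (0 < #|E|)%N -> (0 < #|V|)%N ->
  connectedb G ->
  irreflexive lt -> transitive lt -> (forall x y, x != y -> lt x y || lt y x) ->
  is_triangulation R G T ->
  #|[set A : {set E * V} | [&& simplex_of T A,
       `[< interior_simplex R G A >] &
       (#|A| + k == (#|E| + #|V|).-1)%N]]|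
  = #|[set p : {ffun E -> 'I_#|V|} * {set E} |
        [&& hypertree G (fun e => nat_of_ord (p.1 e)),
            #|p.2| == k &
            [forall e in p.2,
               internally_inactive G lt (fun e => nat_of_ord (p.1 e)) e]]]|.
Proof.
move=> E0 V0 Gc lt_irr lt_trans lt_total Ttri.
(* Codimension [k] and [#|q.2| = k] both say that the index has total [#|V| - 1 - k]. *)
pose deg g := (\sum_e (g : {ffun E -> 'I_#|V|}) e + k == #|V|.-1)%N.
have sums (X : finType) (P : pred X) (d : X -> {ffun E -> 'I_#|V|}) :
    (\sum_(g | deg g) #|[set x | P x & d x == g]|)%N = #|[set x | P x & deg (d x)]|.
  rewrite -sum1dep_card (partition_big d deg) => [|x /andP[]//].
  apply: eq_bigr => g dg; rewrite -sum1dep_card; apply: eq_bigl => x.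
  by rewrite -andbA; congr (_ && _); case: eqVneq => [->|]; rewrite ?dg ?andbF.
transitivity (\sum_(g | deg g) #|[set A | interior_face R G T A &
    simplex_degree V0 A == g]|)%N.
  rewrite sums; apply: eq_card => A; rewrite !inE andbA -/(interior_face R G T A).
  case iA: (interior_face _ _ _ _) => //=; rewrite /deg (card_interior V0 Gc Ttri iA).
  have -> : ((#|E| + #|V|).-1 = #|E| + #|V|.-1)%N by lia.
  by rewrite addnAC [LHS]eq_sym addnC eqn_add2r eq_sym.
under eq_bigr do rewrite (card_interior_degree E0 V0 Gc lt_irr lt_trans lt_total Ttri).
rewrite sums; apply: eq_card => q; rewrite !inE.
transitivity (inactive_subset G lt q && (#|q.2| == k)); last first.
  by rewrite /inactive_subset -andbA; congr (_ && _); rewrite andbC.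
case iq: (inactive_subset _ _ _) => //=.
by rewrite /deg -(pair_degree_sum R E0 iq) eqn_add2l eq_sym.
Qed.
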